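(* Let $\mathfrak g$ be a complex Lie superalgebra, $\mathfrak p$ a ($\mathbb Z_2$-graded) ideal of $\mathfrak g$, and $\phi\colon\mathfrak p\to\mathbb C$ a Lie superalgebra homomorphism. Let $(y_j)_{j\in J}$ be homogeneous elements of the Whittaker annihilator $\mathfrak g^\phi$, indexed by a well-ordered (possibly empty) set $J$, whose classes form a basis of $\mathfrak g^\phi/\mathfrak p$. Then the space of quasi-Whittaker vectors of type $\phi$ in the universal quasi-Whittaker supermodule $W(\phi)$ is $$W(\phi)_\phi=\widetilde{\mathbb C}[y]\,w_\phi .$$
   Context: All Lie superalgebras and supermodules are over $\mathbb C$, of arbitrary dimension; $\mathbb C$ is regarded as a purely even abelian Lie superalgebra (so $\phi$ vanishes on $\mathfrak p_{\bar 1}$ and on $[\mathfrak p,\mathfrak p]$). The Whittaker annihilator of $\phi$ is $\mathfrak g^\phi=\{y\in\mathfrak g\mid \phi([y,p])=0\ \forall p\in\mathfrak p\}$; it is a graded subalgebra containing $\mathfrak p$. For a $\mathfrak g$-supermodule $V$, $V_\phi=\{v\in V\mid pv=\phi(p)v\ \forall p\in\mathfrak p\}$ is the space of quasi-Whittaker vectors of type $\phi$. Let $\mathbb C w_\phi$ be the one-dimensional $\mathfrak p$-supermodule, with $w_\phi$ even, given by $pw_\phi=\phi(p)w_\phi$; the universal quasi-Whittaker supermodule is $W(\phi)=\mathrm{Ind}_{\mathfrak p}^{\mathfrak g}\mathbb C w_\phi=\mathcal U(\mathfrak g)\otimes_{\mathcal U(\mathfrak p)}\mathbb C w_\phi$.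 Let $\widetilde{\mathbb Z}_+^J$ be the set of finitely supported functions $\beta\colon J\to\mathbb Z_{\ge0}$ with $\beta_j\in\{0,1\}$ whenever $y_j$ is odd. For such $\beta$, $y^\beta=y_{j_1}^{\beta_{j_1}}\cdots y_{j_n}^{\beta_{j_n}}\in\mathcal U(\mathfrak g)$, where $j_1>\cdots>j_n$ contain the support of $\beta$ (and $y^0=1$), and $\widetilde{\mathbb C}[y]=\mathrm{Span}_{\mathbb C}\{y^\beta\mid\beta\in\widetilde{\mathbb Z}_+^J\}\subseteq\mathcal U(\mathfrak g)$. *)

(* Defs.v *)
From HB Require Import structures.
From mathcomp Require Import all_boot all_order all_algebra finmap.
From mathcomp Require Import boolp classical_sets reals complex.
From mathcomp.multinomials Require Import monalg.

Set Implicit Arguments.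
Unset Strict Implicit.
Unset Printing Implicit Defensive.

Import Order.TTheory GRing.Theory Num.Theory.

Local Open Scope classical_set_scope.
Local Open Scope ring_scope.

Record submod (K : numFieldType) (V : lmodType K) := Submod {
  submod_pred :> {pred V};
  submod_closedP : submod_closed submod_pred }.

HB.instance Definition _ (K : numFieldType) (V : lmodType K) (S : submod V) :=
  GRing.isSubmodClosed.Build K V (submod_pred S)
    (GRing.submod_closed_semi (submod_closedP S)).

Section Span.
Context {K : numFieldType} {V : lmodType K}.

Definition lspan (A : set V) : set V := [set v | exists s : seq (K * V),
  (forall q, q \in s -> A q.2) /\ v = \sum_(q <- s) q.1 *: q.2].

Lemma span_closed (A : set V) : submod_closed (fun v => `[< lspan A v >]).
Proof.
split=> [|a u v]; first by apply/asboolP; exists [::]; split=> //; rewrite big_nil.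
move=> /asboolP [s [sA ->]] /asboolP [t [tA ->]]; apply/asboolP.
exists ([seq (a * q.1, q.2) | q <- s] ++ t); split=> [q|].
  by rewrite mem_cat => /orP [/mapP [r rs ->]|/tA //]; apply: (sA r).
rewrite big_cat big_map scaler_sumr; congr (_ + _).
by apply: eq_bigr => q _; rewrite scalerA.
Qed.

Definition spanS (A : set V) : submod V := Submod (span_closed A).

Lemma spanSP (A : set V) v : reflect (lspan A v) (v \in spanS A).
Proof. exact: asboolP. Qed.

Lemma span_gen (A : set V) v : A v -> v \in spanS A.
Proof.
move=> Av; apply/spanSP; exists [:: (1, v)]; split=> [q|].
  by rewrite inE => /eqP ->.
by rewrite big_seq1 scale1r.
Qed.

Lemma span_ind (A : set V) (P : V -> Prop) :
  P 0 -> (forall a u v, P u -> P v -> P (a *: u + v)) ->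
  (forall v, A v -> P v) -> forall v, v \in spanS A -> P v.
Proof.
move=> P0 PP AP v /spanSP [s [sA ->]]; elim: s sA => [|q s IH] sA.
  by rewrite big_nil.
rewrite big_cons; apply: PP; first by apply/AP/sA; rewrite mem_head.
by apply: IH => r rs; apply: sA; rewrite inE rs orbT.
Qed.

Definition lin_indep (J : choiceType) (b : J -> V) : Prop :=
  forall c : {fsfun J -> K with 0},
    \sum_(j <- finsupp c) c j *: b j = 0 -> forall j, c j = 0.

Definition is_basis (J : choiceType) (S : set V) (b : J -> V) : Prop :=
  [/\ forall j, S (b j), lin_indep b & S `<=` lspan (range b)].

End Span.

Definition lquot (K : numFieldType) (V : lmodType K) (S : submod V) :=
  Quotient.quot (submod_pred S).
HB.instance Definition _ (K : numFieldType) (V : lmodType K) (S : submod V) :=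
  GRing.Zmodule.on (lquot S).

Definition lpi (K : numFieldType) (V : lmodType K) (S : submod V) (v : V) :
  lquot S := (\pi_(Quotient.quot (submod_pred S)) v)%qT.
Definition lrepr (K : numFieldType) (V : lmodType K) (S : submod V)
  (q : lquot S) : V := repr q.

HB.lock Definition lscale (K : numFieldType) (V : lmodType K) (S : submod V)
  (a : K) (q : lquot S) : lquot S := lpi S (a *: lrepr q).

Section Quotient.
Local Open Scope quotient_scope.
Context {K : numFieldType} {V : lmodType K} (S : submod V).
Local Notation lquot := (lquot S).
Local Notation lpi := (lpi S).
Local Notation lscale := (@lscale K V S).

Lemma lreprK : cancel (@lrepr K V S) lpi. Proof. exact: reprK. Qed.

Lemma lpi_eq u v : lpi u = lpi v <-> u - v \in S.
Proof.
rewrite (rwP eqP) -[lpi u == _]/(\pi_(Quotient.quot (submod_pred S)) u == \pi v).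
by rewrite -Quotient.idealrBE.
Qed.

Lemma lpiB : zmod_morphism lpi.
Proof. exact: pi_is_zmod_morphism. Qed.
HB.instance Definition _ := GRing.isZmodMorphism.Build V lquot lpi lpiB.

Lemma lpi0P v : lpi v = 0 <-> v \in S.
Proof. by rewrite -[0](raddf0 lpi) lpi_eq subr0. Qed.

Lemma lpi_scale a v : lpi (a *: v) = lscale a (lpi v).
Proof.
rewrite unlock; apply/lpi_eq; rewrite -scalerBr rpredZ //.
by apply/lpi_eq; rewrite lreprK.
Qed.

Lemma lscaleA a b q : lscale a (lscale b q) = lscale (a * b) q.
Proof. by rewrite -[q]lreprK -!lpi_scale scalerA. Qed.
Lemma lscale1 : left_id 1 lscale.
Proof. by move=> q; rewrite -[q]lreprK -!lpi_scale scale1r. Qed.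
Lemma lscaleDr : right_distributive lscale +%R.
Proof.
move=> a p q; rewrite -[p]lreprK -[q]lreprK -raddfD -!lpi_scale.
by rewrite scalerDr raddfD.
Qed.
Lemma lscaleDl q : {morph lscale^~ q : a b / a + b}.
Proof. by move=> a b; rewrite -[q]lreprK -!lpi_scale scalerDl raddfD. Qed.

HB.instance Definition _ := GRing.Zmodule_isLmodule.Build K lquot
  lscaleA lscale1 lscaleDr lscaleDl.

Lemma lpiZ : scalable lpi. Proof. exact: lpi_scale. Qed.
HB.instance Definition _ := GRing.isScalable.Build K V lquot *:%R lpi lpiZ.

Definition llift (W : lmodType K) (f : V -> W) (q : lquot) : W := f (lrepr q).

Lemma lliftE (W : lmodType K) (f : {linear V -> W}) :
  (forall v, v \in S -> f v = 0) -> forall v, llift f (lpi v) = f v.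
Proof.
move=> fS v; apply/eqP; rewrite -subr_eq0 -linearB fS //.
by apply/lpi_eq; rewrite lreprK.
Qed.

Lemma llift_linear (W : lmodType K) (f : {linear V -> W}) :
  (forall v, v \in S -> f v = 0) -> linear (llift f).
Proof.
move=> fS a p q; rewrite -[p]lreprK -[q]lreprK -linearP !lliftE //.
by rewrite linearP.
Qed.

End Quotient.

Section Free.
Context {K : numFieldType} {X : choiceType} {V : lmodType K}.

Definition fext (F : X -> V) (t : {malg K[X]}) : V :=
  \sum_(x <- msupp t) t@_x *: F x.

Lemma fextEw F (d : {fset X}) (t : {malg K[X]}) : (msupp t `<=` d)%fset ->
  fext F t = \sum_(x <- d) t@_x *: F x.
Proof.
move=> le; apply: big_fset_incl => // x _ xt.
by rewrite mcoeff_outdom // scale0r.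
Qed.

Lemma fext_linear F : linear (fext F).
Proof.
move=> a s t; set d := (msupp s `|` msupp t)%fset.
have le1 : (msupp s `<=` d)%fset by exact: fsubsetUl.
have le2 : (msupp t `<=` d)%fset by exact: fsubsetUr.
have le3 : (msupp (a *: s + t) `<=` d)%fset.
  apply: fsubset_trans (msuppD_le _ _) _; rewrite fsubUset le2 andbT.
  exact: fsubset_trans (msuppZ_le _ _) le1.
rewrite (fextEw F le1) (fextEw F le2) (fextEw F le3) scaler_sumr -big_split.
by apply: eq_bigr => x _; rewrite mcoeffD mcoeffZ scalerDl scalerA.
Qed.
HB.instance Definition _ F :=
  GRing.isLinear.Build K {malg K[X]} V *:%R (fext F) (fext_linear F).

Lemma fextU F x : fext F << x >> = F x.
Proof. by rewrite /fext msuppU oner_eq0 big_seq_fset1 mcoeffUU scale1r. Qed.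

Lemma malgZU (c : K) (x : X) : << c *g x >> = c *: << x >>.
Proof. by apply/malgP => k; rewrite mcoeffZ !mcoeffU mulr_natr. Qed.

Lemma malg_ext (f h : {malg K[X]} -> V) : linear f -> linear h ->
  (forall x, f << x >> = h << x >>) -> f =1 h.
Proof.
move=> fl hl fh t.
pose F := HB.pack_for {linear {malg K[X]} -> V} f
  (GRing.isLinear.Build K _ V *:%R f fl).
pose H := HB.pack_for {linear {malg K[X]} -> V} h
  (GRing.isLinear.Build K _ V *:%R h hl).
rewrite -[f]/(F : _ -> _) -[h]/(H : _ -> _) [t]monalgE !linear_sum.
by apply: eq_bigr => x _; rewrite malgZU !linearZ /= fh.
Qed.

End Free.

(* Z/2-gradings are indexed by bool, with false even and true odd. *)
Record superspace (K : numFieldType) := SuperSpace {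
  ss_sort :> lmodType K;
  par : bool -> submod ss_sort;
  par_sum : forall x : ss_sort, exists x0 x1,
    [/\ x0 \in par false, x1 \in par true & x = x0 + x1];
  par_direct : forall x : ss_sort,
    x \in par false -> x \in par true -> x = 0 }.

Definition homogeneous (K : numFieldType) (V : superspace K) (x : V) : Prop :=
  exists b, x \in par V b.

(* A numFieldType has characteristic 0, so no further axioms on [x, x] or
   [x, [x, x]] are needed. *)
Record lieSuperAlg (K : numFieldType) := LieSuperAlg {
  lsa_space :> superspace K;
  lie : lsa_space -> lsa_space -> lsa_space;
  lie_linearl : forall y, linear (lie^~ y);
  lie_linearr : forall x, linear (lie x);
  lie_par : forall a b x y, x \in par lsa_space a -> y \in par lsa_space b ->
    lie x y \in par lsa_space (a (+) b);
  lie_skew : forall a b x y, x \in par lsa_space a -> y \in par lsa_space b ->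
    lie x y = - ((-1) ^+ (a && b) *: lie y x);
  lie_jacobi : forall a b c x y z, x \in par lsa_space a ->
    y \in par lsa_space b -> z \in par lsa_space c ->
    lie x (lie y z) = lie (lie x y) z + (-1) ^+ (a && b) *: lie y (lie x z) }.

Record lieSuperHom (K : numFieldType) (g h : lieSuperAlg K) := LieSuperHom {
  lsh_fun :> g -> h;
  lsh_linear : linear lsh_fun;
  lsh_par : forall b x, x \in par g b -> lsh_fun x \in par h b;
  lsh_lie : forall x y, lsh_fun (lie x y) = lie (lsh_fun x) (lsh_fun y) }.

Record is_rep (K : numFieldType) (g : lieSuperAlg K) (V : lmodType K)
    (op : g -> V -> V) : Prop := IsRep {
  rep_linearl : forall v, linear (op^~ v);
  rep_linearr : forall x, linear (op x);
  rep_lie : forall a b x y v, x \in par g a -> y \in par g b ->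
    op (lie x y) v = op x (op y v) - (-1) ^+ (a && b) *: op y (op x v) }.

Record supermodule (K : numFieldType) (g : lieSuperAlg K) := SuperModule {
  smod_space :> superspace K;
  act : g -> smod_space -> smod_space;
  act_rep : is_rep act;
  act_par : forall a b x v, x \in par g a -> v \in par smod_space b ->
    act x v \in par smod_space (a (+) b) }.

Section Parity.
Context {K : numFieldType} (V : superspace K).

Lemma par_uniq (x0 x1 z0 z1 : V) : x0 \in par V false -> z0 \in par V false ->
  x1 \in par V true -> z1 \in par V true -> x0 + x1 = z0 + z1 ->
  x0 = z0 /\ x1 = z1.
Proof.
move=> px0 pz0 px1 pz1 e; have e' : x0 - z0 = z1 - x1.
  by apply/eqP; rewrite subr_eq addrAC [z1 + _]addrC -e addrK.
have /par_direct : x0 - z0 \in par V false by rewrite rpredB.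
rewrite {1}e' rpredB // => /(_ isT) e0; split; apply/eqP.
  by rewrite -subr_eq0 e0.
by rewrite eq_sym -subr_eq0 -e' e0.
Qed.

Lemma sigma_subproof (x : V) : {y : V | exists x0 x1,
  [/\ x0 \in par V false, x1 \in par V true, x = x0 + x1 & y = x0 - x1]}.
Proof.
apply: cid; have [x0 [x1 [p0 p1 ->]]] := par_sum x.
by exists (x0 - x1), x0, x1.
Qed.

(* The parity involution x0 + x1 |-> x0 - x1. *)
Definition sigma (x : V) : V := sval (sigma_subproof x).

Lemma sigmaE x0 x1 : x0 \in par V false -> x1 \in par V true ->
  sigma (x0 + x1) = x0 - x1.
Proof.
move=> p0 p1; rewrite /sigma; case: sigma_subproof => y [z0 [z1 [q0 q1 e ey]]] /=.
by rewrite ey; have [-> ->] := par_uniq p0 q0 p1 q1 e.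
Qed.

Lemma sigma_par b x : x \in par V b -> sigma x = (-1) ^+ b *: x.
Proof.
case: b => px.
  by rewrite -[x in LHS]add0r sigmaE ?rpred0 // sub0r expr1 scaleN1r.
by rewrite -[x in LHS]addr0 sigmaE ?rpred0 // subr0 expr0 scale1r.
Qed.

Lemma sigma_linear : linear sigma.
Proof.
move=> a x y; have [x0 [x1 [p0 p1 ->]]] := par_sum x.
have [y0 [y1 [q0 q1 ->]]] := par_sum y.
rewrite scalerDr addrACA !sigmaE ?rpredD ?rpredZ //.
by rewrite scalerBr opprD addrACA.
Qed.
HB.instance Definition _ := GRing.isLinear.Build K V V *:%R sigma sigma_linear.

Lemma sigmaD : {morph sigma : x y / x + y}. Proof. exact: linearD. Qed.

Lemma sigma_in b x : x \in par V b -> sigma x \in par V b.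
Proof. by move=> px; rewrite (sigma_par px) rpredZ. Qed.

Lemma par_sum_ind (P : V -> Prop) :
  (forall x y, P x -> P y -> P (x + y)) ->
  (forall b x, x \in par V b -> P x) -> forall x, P x.
Proof.
move=> PD Pp x; have [x0 [x1 [p0 p1 ->]]] := par_sum x.
by apply: PD; [apply: (Pp false)|apply: (Pp true)].
Qed.

Lemma direct_of_involution (W : lmodType K) (s : W -> W) (x : W) :
  s x = (-1) ^+ false *: x -> s x = (-1) ^+ true *: x -> x = 0.
Proof.
move=> -> /eqP; rewrite expr0 expr1 scale1r scaleN1r -addr_eq0 -mulr2n.
by rewrite -scaler_nat scaler_eq0 pnatr_eq0 => /eqP.
Qed.

End Parity.

Lemma sigma_lie (K : numFieldType) (g : lieSuperAlg K) (x y : g) :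
  sigma (lie x y) = lie (sigma x) (sigma y).
Proof.
have D1 z u v : lie (u + v) z = lie u z + lie v z :> g.
  by have := lie_linearl z 1 u v; rewrite !scale1r.
have D2 z u v : lie z (u + v) = lie z u + lie z v :> g.
  by have := lie_linearr z 1 u v; rewrite !scale1r.
have Z1 a u v : lie (a *: u) v = a *: lie u v :> g.
  have l0 : lie 0 v = 0 :> g.
    by have := D1 v 0 0; rewrite addr0 => /eqP; rewrite -subr_eq0 opprD addNKr oppr_eq0 => /eqP.
  by have := lie_linearl v a u 0; rewrite !addr0 l0 addr0.
have Z2 a u v : lie u (a *: v) = a *: lie u v :> g.
  have l0 : lie u 0 = 0 :> g.
    by have := D2 u 0 0; rewrite addr0 => /eqP; rewrite -subr_eq0 opprD addNKr oppr_eq0 => /eqP.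
  by have := lie_linearr u a v 0; rewrite !addr0 l0 addr0.
move: x; apply: par_sum_ind => [u v IHu IHv|a x px]; first by rewrite D1 !sigmaD IHu IHv D1.
move: y; apply: par_sum_ind => [u v IHu IHv|b y py]; first by rewrite D2 !sigmaD IHu IHv D2.
rewrite (sigma_par px) (sigma_par py) (sigma_par (lie_par px py)) Z1 Z2 scalerA.
by congr (_ *: _); rewrite -signr_addb.
Qed.

Definition sigma_hom (K : numFieldType) (g : lieSuperAlg K) : lieSuperHom g g :=
  LieSuperHom (@sigma_linear K g) (@sigma_in K g) (@sigma_lie K g).

Section Enveloping.
Context {K : numFieldType} (g : lieSuperAlg K).

Definition falg := {malg K[{fmonom g}]}.
HB.instance Definition _ := GRing.Lalgebra.on falg.

Definition fvar (x : g) : falg := << fmu x >>.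

(* Dividing the free algebra on the set g by the first relation gives the
   tensor algebra of the vector space g. *)
Inductive uenv_rel : set falg :=
| uenv_rel_lin a x y : uenv_rel (fvar (a *: x + y) - (a *: fvar x + fvar y))
| uenv_rel_lie a b x y : x \in par g a -> y \in par g b ->
    uenv_rel (fvar x * fvar y - (-1) ^+ (a && b) *: (fvar y * fvar x)
              - fvar (lie x y)).

Definition uenv_ideal : submod falg :=
  spanS [set t | exists s r s', uenv_rel r /\ t = s * r * s'].

Definition uenv := lquot uenv_ideal.
HB.instance Definition _ := GRing.Lmodule.on uenv.

Lemma falgMU (v w : {fmonom g}) :
  << v >> * << w >> = << mmul v w >> :> {malg K[{fmonom g}]}.
Proof. by rewrite malgM_def fgmulUU mulr1. Qed.

Lemma falgC (a : K) (s : falg) : s * a%:MP = a%:MP * s.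
Proof.
rewrite [s]monalgE mulr_suml mulr_sumr; apply: eq_bigr => w _.
by rewrite !malgM_def !fgmulUU mulrC mulm1 mul1m.
Qed.

Lemma falgAr (a : K) (s t : falg) : a *: (s * t) = s * (a *: t).
Proof. by rewrite -!mul_malgC !mulrA falgC. Qed.

Lemma uenv_idealMl s t : t \in uenv_ideal -> s * t \in uenv_ideal.
Proof.
move: t; apply: span_ind => [|a u v hu hv|_ [s1 [r [s2 [ur ->]]]]].
- by rewrite mulr0 rpred0.
- by rewrite mulrDr -falgAr; apply: rpredD hv; apply: rpredZ hu.
- by rewrite [s * _]mulrA [s * _]mulrA; apply: span_gen; exists (s * s1), r, s2.
Qed.

Lemma uenv_idealMr s t : t \in uenv_ideal -> t * s \in uenv_ideal.
Proof.
move: t; apply: span_ind => [|a u v hu hv|_ [s1 [r [s2 [ur ->]]]]].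
- by rewrite mul0r rpred0.
- by rewrite mulrDl -scalerAl; apply: rpredD hv; apply: rpredZ hu.
- by apply: span_gen; exists s1, r, (s2 * s); rewrite [RHS]mulrA.
Qed.

Definition upi (t : falg) : uenv := lpi uenv_ideal t.
HB.instance Definition _ := GRing.Linear.copy upi (lpi uenv_ideal).

Lemma upiZ a t : upi (a *: t) = a *: upi t. Proof. exact: linearZ. Qed.

End Enveloping.

HB.lock Definition umul (K : numFieldType) (g : lieSuperAlg K)
  (u v : uenv g) : uenv g := upi (lrepr u * lrepr v).

Section EnvelopingRing.
Context {K : numFieldType} (g : lieSuperAlg K).
Local Notation falg := (falg g).
Local Notation uenv := (uenv g).
Local Notation umul := (@umul K g).

Definition uone : uenv := upi 1.

Lemma upi_mul s t : upi (s * t) = umul (upi s) (upi t).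
Proof.
rewrite unlock; apply/lpi_eq; set s' := lrepr _; set t' := lrepr _.
have -> : s * t - s' * t' = (s - s') * t + s' * (t - t').
  by rewrite mulrBl mulrBr addrA subrK.
apply: rpredD; [apply: uenv_idealMr|apply: uenv_idealMl];
  by apply/lpi_eq; rewrite lreprK.
Qed.

Lemma upiW (P : uenv -> Prop) : (forall t, P (upi t)) -> forall u, P u.
Proof. by move=> Pt u; rewrite -[u]lreprK; apply: Pt. Qed.

Lemma umulA : associative umul.
Proof.
elim/upiW=> s; elim/upiW=> t; elim/upiW=> r.
by rewrite -!upi_mul mulrA.
Qed.
Lemma umul1l : left_id uone umul.
Proof. by elim/upiW=> s; rewrite -upi_mul mul1r. Qed.
Lemma umul1r : right_id uone umul.
Proof. by elim/upiW=> s; rewrite -upi_mul mulr1. Qed.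
Lemma umulDl : left_distributive umul +%R.
Proof.
elim/upiW=> s; elim/upiW=> t; elim/upiW=> r.
by rewrite -raddfD -!upi_mul mulrDl raddfD.
Qed.
Lemma umulDr : right_distributive umul +%R.
Proof.
elim/upiW=> s; elim/upiW=> t; elim/upiW=> r.
by rewrite -raddfD -!upi_mul mulrDr raddfD.
Qed.
HB.instance Definition _ := GRing.Zmodule_isPzRing.Build uenv
  umulA umul1l umul1r umulDl umulDr.

Lemma upiM s t : upi (s * t) = upi s * upi t. Proof. exact: upi_mul. Qed.

(* The canonical map g -> U(g). *)
Definition uiota (x : g) : uenv := upi (fvar x).

End EnvelopingRing.

Arguments uiota {K g} x.

Section FreeAction.
Context {K : numFieldType} {g : lieSuperAlg K} {V : lmodType K}.
Variable op : g -> V -> V.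

Definition fmact (t : falg g) (v : V) : V :=
  fext (fun w : {fmonom g} => foldr op v w) t.

Lemma fmactPl v : linear (fmact^~ v). Proof. exact: linearP. Qed.
Lemma fmact0l v : fmact 0 v = 0. Proof. exact: linear0. Qed.
Lemma fmactBl v s t : fmact (s - t) v = fmact s v - fmact t v.
Proof. exact: linearB. Qed.
Lemma fmactDl v s t : fmact (s + t) v = fmact s v + fmact t v.
Proof. exact: linearD. Qed.
Lemma fmactZl v a t : fmact (a *: t) v = a *: fmact t v.
Proof. exact: linearZ. Qed.

End FreeAction.

(* The action of U(g) on V extending op, so that the class of a word
   x1 ... xn acts as op x1 \o ... \o op xn. *)
HB.lock Definition uact (K : numFieldType) (g : lieSuperAlg K)
  (V : lmodType K) (op : g -> V -> V) (u : uenv g) (v : V) : V :=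
  fmact op (lrepr u) v.

Section Action.
Context {K : numFieldType} {g : lieSuperAlg K} {V : lmodType K}.
Variable op : g -> V -> V.
Local Notation falg := (falg g).
Local Notation uenv := (uenv g).
Local Notation fmact := (fmact op).
Local Notation uenv_ideal := (uenv_ideal g).
Local Notation uact := (uact op).

Hypothesis opP : is_rep op.

Lemma foldr_linear (w : seq g) : linear (foldr op ^~ w).
Proof. by elim: w => //= x w IH a u v; rewrite IH (rep_linearr opP). Qed.

Lemma fmact_linearr t : linear (fmact t).
Proof.
move=> a u v; rewrite /fmact /fext scaler_sumr -big_split; apply: eq_bigr => w _.
by rewrite foldr_linear /= scalerDr !scalerA mulrC.
Qed.
HB.instance Definition _ t :=
  GRing.isLinear.Build K V V *:%R (fmact t) (fmact_linearr t).

Lemma fmactU (w : {fmonom g}) v : fmact << w >> v = foldr op v w.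
Proof. exact: fextU. Qed.

Lemma fmact1 v : fmact 1 v = v.
Proof. by rewrite (_ : 1 = << mone >> :> falg) // fmactU fm1. Qed.

Lemma fmact_var x v : fmact (fvar x) v = op x v.
Proof. by rewrite fmactU fmU. Qed.

Lemma fmactM s t v : fmact (s * t) v = fmact s (fmact t v).
Proof.
apply: (@malg_ext _ _ _ (fun s => fmact (s * t) v) (fmact^~ (fmact t v))) s.
- by move=> a u u'; rewrite mulrDl -scalerAl fmactPl.
- exact: fmactPl.
move=> w; move: t.
apply: (@malg_ext _ _ _ (fun t => fmact (<< w >> * t) v)
         (fun t => fmact << w >> (fmact t v))).
- by move=> a u u'; rewrite mulrDr -falgAr fmactPl.
- by move=> a u u'; rewrite fmactPl linearP.
by move=> w'; rewrite falgMU !fmactU fmM foldr_cat.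
Qed.

Lemma fmact_varM x y v : fmact (fvar x * fvar y) v = op x (op y v).
Proof. by rewrite (fmactM (fvar x) (fvar y) v) (fmact_var y v) fmact_var. Qed.

Lemma fmact_rel r v : uenv_rel r -> fmact r v = 0.
Proof.
case=> [a x y|a b x y px py].
  by rewrite fmactBl fmactDl fmactZl !fmact_var (rep_linearl opP) subrr.
rewrite (fmactBl op v (_ - _) _) (fmactBl op v (_ * _) _) fmactZl.
transitivity (op x (op y v) - (-1) ^+ (a && b) *: op y (op x v) - op (lie x y) v).
  by congr (_ - _ *: _ - _); [exact: fmact_varM|exact: fmact_varM|exact: fmact_var].
by rewrite (rep_lie opP _ px py) subrr.
Qed.

Lemma fmact_ideal t v : t \in uenv_ideal -> fmact t v = 0.
Proof.
move: t; apply: span_ind => [|a s s' e e'|_ [s [r [s' [ur ->]]]]].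
- by rewrite fmact0l.
- by rewrite fmactPl e e' scaler0 addr0.
- by rewrite !fmactM (fmact_rel _ ur) linear0.
Qed.

Lemma uact_pi t v : uact (upi t) v = fmact t v.
Proof. rewrite unlock; exact: (lliftE (fun t => @fmact_ideal t v)). Qed.

Lemma uact_linearl v : linear (uact^~ v).
Proof. rewrite unlock; exact: (llift_linear (fun t => @fmact_ideal t v)). Qed.

Lemma uact_linearr u : linear (uact u).
Proof. rewrite unlock; exact: fmact_linearr. Qed.

Lemma uact1 v : uact 1 v = v. Proof. by rewrite uact_pi fmact1. Qed.

Lemma uactM u u' v : uact (u * u') v = uact u (uact u' v).
Proof.
move: u u'; apply: upiW => s; apply: upiW => t.
by rewrite -upiM (uact_pi t v) (uact_pi (s * t)) (uact_pi s) fmactM.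
Qed.

Lemma uact_uiota x v : uact (uiota x) v = op x v.
Proof. by rewrite uact_pi fmact_var. Qed.

End Action.

Section EnvelopingAlgebra.
Context {K : numFieldType} (g : lieSuperAlg K).
Local Notation uenv := (uenv g).

Lemma uenv_nonzero : 1 != 0 :> uenv.
Proof.
pose op (_ : g) (_ : K^o) : K^o := 0.
have opP : is_rep op.
  split=> [v a x y|x a u v|a b x y v _ _]; rewrite /= /op ?scaler0 ?addr0 //.
  by rewrite subrr.
apply/eqP => e; have := uact1 opP 1; rewrite e.
have -> : (0 : uenv) = upi 0 by rewrite linear0.
rewrite (uact_pi opP) fmact0l => /eqP.
by rewrite eq_sym oner_eq0.
Qed.
HB.instance Definition _ :=
  GRing.PzSemiRing_isNonZero.Build uenv uenv_nonzero.

Lemma uenv_Al (a : K) (u v : uenv) : a *: (u * v) = a *: u * v.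
Proof.
move: u v; apply: upiW => s; apply: upiW => t.
by rewrite -upiM -upiZ scalerAl upiM upiZ.
Qed.
HB.instance Definition _ := GRing.Lmodule_isLalgebra.Build K uenv uenv_Al.

Lemma uenv_Ar (a : K) (u v : uenv) : a *: (u * v) = u * (a *: v).
Proof.
move: u v; apply: upiW => s; apply: upiW => t.
by rewrite -upiM -upiZ falgAr upiM upiZ.
Qed.
HB.instance Definition _ := GRing.Lalgebra_isAlgebra.Build K uenv uenv_Ar.

Lemma uiota_linear : linear (@uiota K g).
Proof.
move=> a x y; rewrite /uiota -linearP /=; apply/lpi_eq; apply: span_gen.
exists 1, (fvar (a *: x + y) - (a *: fvar x + fvar y)), 1.
by rewrite mul1r mulr1; split => //; constructor.
Qed.
HB.instance Definition _ := GRing.isLinear.Build K g uenv *:%R (@uiota K g) uiota_linear.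

Lemma uiota_lie a b x y : x \in par g a -> y \in par g b ->
  uiota (lie x y) = uiota x * uiota y - (-1) ^+ (a && b) *: (uiota y * uiota x).
Proof.
move=> px py; apply/esym; rewrite /uiota -!upiM -upiZ -linearB.
apply/lpi_eq; apply: span_gen; exists 1.
eexists; exists 1; rewrite mul1r mulr1; split; last by [].
exact: uenv_rel_lie.
Qed.

Lemma uenv_ind (S : submod uenv) : 1 \in S ->
  (forall x u, u \in S -> uiota x * u \in S) -> forall u, u \in S.
Proof.
move=> S1 SM; apply: upiW => t; rewrite [t]monalgE linear_sum rpred_sum // => w _.
rewrite malgZU linearZ /= rpredZ //; case: w => w; elim: w => [|x w IH].
  by rewrite (_ : FMonom [::] = mone) //; apply/eqP; rewrite fmP fm1.
have -> : FMonom (x :: w) = mmul (fmu x) (FMonom w).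
  by apply/eqP; rewrite fmP fmM fmU.
by rewrite -falgMU upiM SM.
Qed.

Lemma uenv_indP (P : uenv -> Prop) : P 1 ->
  (forall a u v, P u -> P v -> P (a *: u + v)) ->
  (forall x u, P u -> P (uiota x * u)) -> forall u, P u.
Proof.
move=> P1 PP PM u; have cl : submod_closed (fun u => `[< P u >]).
  split=> [|a v w]; last by move=> /asboolP Pv /asboolP Pw; apply/asboolP/PP.
  by apply/asboolP; have := PP (-1) 1 1 P1 P1; rewrite scaleN1r addNr.
apply/asboolP; apply: (@uenv_ind (Submod cl)); first exact/asboolP.
by move=> x v /asboolP Pv; apply/asboolP/PM.
Qed.

End EnvelopingAlgebra.

Section EnvelopingMap.
Context {K : numFieldType} {h g : lieSuperAlg K} (f : lieSuperHom h g).

Definition umap_op (x : h) (v : uenv g) : uenv g := uiota (f x) * v.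

(* The algebra morphism U(f) : U(h) -> U(g). *)
Definition umap (q : uenv h) : uenv g := uact umap_op q 1.

Lemma umap_rep : is_rep umap_op.
Proof.
split=> [v a x y|x a u v|a b x y v px py]; rewrite /umap_op.
- by rewrite lsh_linear linearP mulrDl -scalerAl.
- by rewrite mulrDr -scalerAr.
- rewrite lsh_lie (uiota_lie (lsh_par f px) (lsh_par f py)) mulrBl -scalerAl.
  by rewrite !mulrA.
Qed.

Lemma umap_linear : linear umap.
Proof. exact: uact_linearl umap_rep _. Qed.
HB.instance Definition _ := GRing.isLinear.Build K _ _ *:%R umap umap_linear.

Lemma umap1 : umap 1 = 1. Proof. exact: uact1 umap_rep _. Qed.

Lemma umap_cons x q : umap (uiota x * q) = uiota (f x) * umap q.
Proof.
by rewrite /umap (uactM umap_rep (uiota x) q) (uact_uiota umap_rep x).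
Qed.

Lemma umap_uact q v : uact umap_op q v = umap q * v.
Proof.
move: q; apply: uenv_indP => [|a u w eu ew|x u eu].
- by rewrite (uact1 umap_rep) umap1 mul1r.
- by rewrite linearP (uact_linearl umap_rep) eu ew mulrDl -scalerAl.
- rewrite umap_cons (uactM umap_rep (uiota x) u) (uact_uiota umap_rep x) eu.
  exact: mulrA.
Qed.

Lemma umapM q r : umap (q * r) = umap q * umap r.
Proof. by rewrite -umap_uact -(uactM umap_rep). Qed.

Lemma umap_uiota x : umap (uiota x) = uiota (f x).
Proof. by rewrite /umap (uact_uiota umap_rep) /umap_op mulr1. Qed.

Lemma lsh_sigma x : f (sigma x) = sigma (f x).
Proof.
pose F := HB.pack_for {linear h -> g} (f : h -> g)
  (GRing.isLinear.Build K h g *:%R (f : h -> g) (lsh_linear f)).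
have FD u v : f (u + v) = f u + f v by exact: (linearD F).
have FZ a u : f (a *: u) = a *: f u by exact: (linearZ_LR F).
move: x; apply: par_sum_ind => [u v eu ev|b x px].
  by rewrite sigmaD !FD eu ev sigmaD.
by rewrite (sigma_par px) (sigma_par (lsh_par f px)) FZ.
Qed.

End EnvelopingMap.

Section TensorDef.
Context {K : numFieldType} {A : Type} {M N : lmodType K}.
Variables (ra : M -> A -> M) (la : A -> N -> N).

Inductive tens_rel : set {malg K[(M * N)%type]} :=
| tens_rel_l a m m' n :
    tens_rel (<< (a *: m + m', n) >> - (a *: << (m, n) >> + << (m', n) >>))
| tens_rel_r a m n n' :
    tens_rel (<< (m, a *: n + n') >> - (a *: << (m, n) >> + << (m, n') >>))
| tens_rel_bal m c n : tens_rel (<< (ra m c, n) >> - << (m, la c n) >>).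

(* M tensor N over A, for a right action ra and a left action la of A. *)
Definition tens := lquot (spanS tens_rel).
HB.instance Definition _ := GRing.Lmodule.on tens.

End TensorDef.

HB.lock Definition tpure (K : numFieldType) (A : Type) (M N : lmodType K)
  (ra : M -> A -> M) (la : A -> N -> N) (m : M) (n : N) : tens ra la :=
  lpi (spanS (tens_rel ra la)) << (m, n) >>.

(* The endomorphism m tensor n |-> al m tensor be n, when it exists. *)
HB.lock Definition tmap (K : numFieldType) (A : Type) (M N : lmodType K)
  (ra : M -> A -> M) (la : A -> N -> N) (al : M -> M) (be : N -> N)
  (t : tens ra la) : tens ra la :=
  llift (fext (fun q : M * N => tpure ra la (al q.1) (be q.2))) t.

Section Tensor.
Context {K : numFieldType} {A : Type} {M N : lmodType K}.
Variables (ra : M -> A -> M) (la : A -> N -> N).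
Local Notation tens := (tens ra la).
Local Notation tens_rel := (tens_rel ra la).
Local Notation tpure := (tpure ra la).

Lemma tpurel n : linear (tpure^~ n).
Proof.
move=> a m m'; rewrite unlock -linearP /=; apply/lpi_eq; apply: span_gen.
exact: tens_rel_l.
Qed.

Lemma tpurer m : linear (tpure m).
Proof.
move=> a n n'; rewrite unlock -linearP /=; apply/lpi_eq; apply: span_gen.
exact: tens_rel_r.
Qed.

Lemma tpure_bal m c n : tpure (ra m c) n = tpure m (la c n).
Proof. by rewrite unlock; apply/lpi_eq; apply: span_gen; exact: tens_rel_bal. Qed.

Lemma tens_ind (P : tens -> Prop) : P 0 ->
  (forall a u v, P u -> P v -> P (a *: u + v)) ->
  (forall m n, P (tpure m n)) -> forall t, P t.
Proof.
move=> P0 PP Pp t; rewrite -[t]lreprK [lrepr t]monalgE linear_sum.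
elim/big_ind: _ => [//|u v Pu Pv|[m n] _]; first by rewrite -[u]scale1r; apply: PP.
rewrite malgZU linearZ /= -[_ *: _]addr0; apply: PP P0.
by have := Pp m n; rewrite unlock.
Qed.

Section Map.
Variables (al : M -> M) (be : N -> N) (ga : A -> A).
Hypotheses (alL : linear al) (beL : linear be).
Hypothesis alA : forall m c, al (ra m c) = ra (al m) (ga c).
Hypothesis beA : forall c n, be (la c n) = la (ga c) (be n).

Definition tmap_fun (q : M * N) : tens := tpure (al q.1) (be q.2).

Lemma tmap_rel t : t \in spanS tens_rel -> fext tmap_fun t = 0.
Proof.
move: t; apply: span_ind => [|a u v eu ev|_ [a m m' n|a m n n'|m c n]].
- exact: linear0.
- by rewrite linearP /= eu ev scaler0 addr0.
- by rewrite linearB linearD linearZ /= !fextU /tmap_fun /= alL tpurel subrr.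
- by rewrite linearB linearD linearZ /= !fextU /tmap_fun /= beL tpurer subrr.
- by rewrite linearB /= !fextU /tmap_fun /= alA beA tpure_bal subrr.
Qed.

Lemma tmapE m n : tmap al be (tpure m n) = tpure (al m) (be n).
Proof.
rewrite tmap.unlock; transitivity (llift (fext tmap_fun) (lpi (spanS tens_rel) << (m, n) >>)).
  by congr llift; rewrite unlock.
exact: etrans (lliftE tmap_rel _) (fextU _ _).
Qed.

Lemma tmap_linear : linear (tmap al be : tens -> tens).
Proof. rewrite tmap.unlock; exact: llift_linear tmap_rel. Qed.
End Map.

End Tensor.

Section Grading.
Context {K : numFieldType} {g : lieSuperAlg K}.

Inductive homog_word : bool -> set (uenv g) :=
| homog_word1 : homog_word false 1
| homog_wordM a b x u : x \in par g a -> homog_word b u ->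
    homog_word (a (+) b) (uiota x * u).

Definition upar (b : bool) : submod (uenv g) := spanS (homog_word b).

Lemma uparM a b x u : x \in par g a -> u \in upar b ->
  uiota x * u \in upar (a (+) b).
Proof.
move=> px; move: u; apply: span_ind => [|c u v pu pv|u hu].
- by rewrite mulr0 rpred0.
- by rewrite mulrDr -scalerAr rpredD ?rpredZ.
- by apply: span_gen; constructor.
Qed.

Lemma upar_sum (u : uenv g) : exists u0 u1,
  [/\ u0 \in upar false, u1 \in upar true & u = u0 + u1].
Proof.
move: u; apply: uenv_indP => [|a u v|x u].
- by exists 1, 0; rewrite rpred0 addr0; split=> //; apply/span_gen; constructor.
- move=> [u0 [u1 [p0 p1 ->]]] [v0 [v1 [q0 q1 ->]]].
  exists (a *: u0 + v0), (a *: u1 + v1); rewrite !rpredD ?rpredZ //; split=> //.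
  by rewrite scalerDr addrACA.
- move=> [u0 [u1 [p0 p1 ->]]]; have [x0 [x1 [q0 q1 ->]]] := par_sum x.
  exists (uiota x0 * u0 + uiota x1 * u1), (uiota x0 * u1 + uiota x1 * u0).
  split; last by rewrite linearD mulrDl !mulrDr [X in _ + X]addrC addrACA.
    by apply: rpredD; [apply: (uparM q0 p0)|apply: (uparM q1 p1)].
  by apply: rpredD; [apply: (uparM q0 p1)|apply: (uparM q1 p0)].
Qed.

Definition usig : uenv g -> uenv g := umap (sigma_hom g).

Lemma usig_linear : linear usig. Proof. exact: umap_linear. Qed.
HB.instance Definition _ := GRing.isLinear.Build K _ _ *:%R usig usig_linear.
Lemma usig1 : usig 1 = 1. Proof. exact: umap1. Qed.
Lemma usigM u v : usig (u * v) = usig u * usig v. Proof. exact: umapM. Qed.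
Lemma usig_uiota x : usig (uiota x) = uiota (sigma x).
Proof. exact: umap_uiota. Qed.

Lemma usig_par b u : u \in upar b -> usig u = (-1) ^+ b *: u.
Proof.
move: u; apply: span_ind => [|a u v eu ev|u].
- by rewrite linear0 scaler0.
- by rewrite usig_linear eu ev scalerDr !scalerA mulrC.
elim=> [|a {}b x {}u px _ IH]; first by rewrite usig1 scale1r.
rewrite usigM usig_uiota IH (sigma_par px) linearZ /= -scalerAr -scalerAl.
by rewrite scalerA mulrC -signr_addb.
Qed.

Lemma sigma_act (M : supermodule g) x (m : M) :
  sigma (act x m) = act (sigma x) (sigma m).
Proof.
have RP := act_rep M.
have D1 z u v : act (u + v) z = act u z + act v z :> M.
  by have := rep_linearl RP z 1 u v; rewrite !scale1r.
have D2 z u v : act z (u + v) = act z u + act z v :> M.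
  by have := rep_linearr RP z 1 u v; rewrite !scale1r.
have Z1 a u v : act (a *: u) v = a *: act u v :> M.
  have := rep_linearl RP v a u 0; rewrite addr0 => ->.
  have := rep_linearl RP v (-1) 0 0; rewrite scaler0 addr0 scaleN1r addNr => ->.
  by rewrite addr0.
have Z2 a u v : act u (a *: v) = a *: act u v :> M.
  have := rep_linearr RP u a v 0; rewrite addr0 => ->.
  have := rep_linearr RP u (-1) 0 0; rewrite scaler0 addr0 scaleN1r addNr => ->.
  by rewrite addr0.
move: x; apply: par_sum_ind => [u v eu ev|a x px].
  by rewrite D1 !sigmaD eu ev D1.
move: m; apply: par_sum_ind => [u v eu ev|b m pm].
  by rewrite D2 !sigmaD eu ev D2.
rewrite (sigma_par px) (sigma_par pm) (sigma_par (act_par px pm)) Z1 Z2 scalerA.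
by rewrite -signr_addb.
Qed.

Lemma sigma_uact (M : supermodule g) q (m : M) :
  sigma (uact (@act K g M) q m) = uact (@act K g M) (usig q) (sigma m).
Proof.
have RP := act_rep M; move: q; apply: uenv_indP => [|a u v eu ev|x u eu].
- by rewrite usig1 !(uact1 RP).
- by rewrite (uact_linearl RP) sigma_linear eu ev usig_linear (uact_linearl RP).
- rewrite usigM usig_uiota (uactM RP (uiota x)) (uactM RP (uiota _)).
  by rewrite !(uact_uiota RP) -eu sigma_act.
Qed.

End Grading.

Section Induced.
Context {K : numFieldType} {h g : lieSuperAlg K}.
Variables (f : lieSuperHom h g) (M : supermodule h).

Definition ind_ra (u : uenv g) (q : uenv h) : uenv g := u * umap f q.
Definition ind_la (q : uenv h) (m : M) : M := uact (@act K h M) q m.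

Definition ind_sort := tens ind_ra ind_la.
HB.instance Definition _ := GRing.Lmodule.on ind_sort.

Definition ind_pure (u : uenv g) (m : M) : ind_sort := tpure ind_ra ind_la u m.

Definition ind_act (x : g) : ind_sort -> ind_sort :=
  tmap (fun u => uiota x * u) id.

Lemma ind_mul_linear (x : g) : linear (fun u : uenv g => uiota x * u).
Proof. by move=> a u v; rewrite mulrDr -scalerAr. Qed.

Lemma ind_id_linear : linear (@id M). Proof. by []. Qed.

Lemma ind_actE x u m : ind_act x (ind_pure u m) = ind_pure (uiota x * u) m.
Proof.
apply: (tmapE (ga := id) (ind_mul_linear x) ind_id_linear) => //.
by move=> v q; rewrite /ind_ra mulrA.
Qed.

Lemma ind_act_linear x : linear (ind_act x).
Proof.
apply: (tmap_linear (ga := id) (ind_mul_linear x) ind_id_linear) => //.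
by move=> v q; rewrite /ind_ra mulrA.
Qed.
HB.instance Definition _ x :=
  GRing.isLinear.Build K _ _ *:%R (ind_act x) (ind_act_linear x).

Lemma ind_act0 x : ind_act x 0 = 0. Proof. exact: linear0. Qed.

Lemma ind_rep : is_rep ind_act.
Proof.
split=> [v a x y| |a b x y v px py]; last 2 first.
- exact: ind_act_linear.
- move: v; apply: tens_ind => [|c u v eu ev|u m].
  + by rewrite !ind_act0 scaler0 subr0.
  + rewrite !ind_act_linear eu ev [in LHS]scalerBr [in RHS]scalerDr opprD.
    by rewrite addrACA !scalerA [c * _]mulrC.
  rewrite -[tpure _ _ _ _]/(ind_pure u m) !ind_actE (uiota_lie px py) mulrBl.
  rewrite -scalerAl !mulrA addrC -scaleNr [LHS]tpurel scaleNr addrC.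
  by [].
move: v; apply: tens_ind => [|c u v eu ev|u m].
- by rewrite !ind_act0 scaler0 addr0.
- rewrite !ind_act_linear eu ev [in LHS]scalerDr [in RHS]scalerDr addrACA.
  by rewrite !scalerA [c * _]mulrC.
rewrite -[tpure _ _ _ _]/(ind_pure u m) !ind_actE linearP mulrDl -scalerAl.
exact: tpurel.
Qed.

Lemma uact_ind u v m : uact ind_act u (ind_pure v m) = ind_pure (u * v) m.
Proof.
move: u; apply: uenv_indP => [|a u w eu ew|x u eu].
- by rewrite (uact1 ind_rep) mul1r.
- rewrite (uact_linearl ind_rep) eu ew mulrDl -scalerAl.
  exact: esym (tpurel ind_ra ind_la m a (u * v) (w * v)).
- by rewrite (uactM ind_rep (uiota x)) (uact_uiota ind_rep) eu ind_actE mulrA.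
Qed.

Definition ind_par (b : bool) : submod ind_sort :=
  spanS [set t | exists c u d m, [/\ u \in upar c, m \in par M d, b = c (+) d
                                   & t = ind_pure u m]].

Lemma ind_pure_par c d u m : u \in upar c -> m \in par M d ->
  ind_pure u m \in ind_par (c (+) d).
Proof. by move=> pu pm; apply: span_gen; exists c, u, d, m. Qed.

Lemma ind_par_sum (t : ind_sort) : exists t0 t1,
  [/\ t0 \in ind_par false, t1 \in ind_par true & t = t0 + t1].
Proof.
move: t; apply: tens_ind => [|a u v|u m].
- by exists 0, 0; rewrite !rpred0 addr0.
- move=> [u0 [u1 [p0 p1 ->]]] [v0 [v1 [q0 q1 ->]]].
  exists (a *: u0 + v0), (a *: u1 + v1); rewrite !rpredD ?rpredZ //; split=> //.
  by rewrite scalerDr addrACA.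
have [u0 [u1 [p0 p1 ->]]] := upar_sum u; have [m0 [m1 [q0 q1 ->]]] := par_sum m.
exists (ind_pure u0 m0 + ind_pure u1 m1), (ind_pure u0 m1 + ind_pure u1 m0).
split.
- by apply: rpredD; [apply: (ind_pure_par p0 q0)|apply: (ind_pure_par p1 q1)].
- by apply: rpredD; [apply: (ind_pure_par p0 q1)|apply: (ind_pure_par p1 q0)].
rewrite -[tpure _ _ _ _]/(ind_pure _ _).
have D1 n v w : ind_pure (v + w) n = ind_pure v n + ind_pure w n.
  by have := tpurel ind_ra ind_la n 1 v w; rewrite !scale1r.
have D2 v n n' : ind_pure v (n + n') = ind_pure v n + ind_pure v n'.
  by have := tpurer ind_ra ind_la v 1 n n'; rewrite !scale1r.
by rewrite D1 !D2 [X in _ + X]addrC addrACA.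
Qed.

Definition ind_sigma : ind_sort -> ind_sort := tmap usig (@sigma K M).

Lemma usig_umap q : usig (umap f q) = umap f (usig q).
Proof.
move: q; apply: uenv_indP => [|a u v eu ev|x u eu].
- by rewrite umap1 !usig1 umap1.
- by rewrite umap_linear !usig_linear eu ev umap_linear.
- rewrite umap_cons !usigM !usig_uiota eu umapM umap_uiota.
  by rewrite lsh_sigma.
Qed.

Lemma usig_ra u q : usig (ind_ra u q) = ind_ra (usig u) (usig q).
Proof. by rewrite /ind_ra usigM usig_umap. Qed.

Lemma ind_sigmaE u m : ind_sigma (ind_pure u m) = ind_pure (usig u) (sigma m).
Proof.
apply: (tmapE (ga := usig) (@usig_linear K g) (@sigma_linear K M) usig_ra).
exact: sigma_uact.
Qed.

Lemma ind_sigma_linear : linear ind_sigma.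
Proof.
apply: (tmap_linear (ga := usig) (@usig_linear K g) (@sigma_linear K M) usig_ra).
exact: sigma_uact.
Qed.
HB.instance Definition _ :=
  GRing.isLinear.Build K _ _ *:%R ind_sigma ind_sigma_linear.

Lemma ind_sigma_par b t : t \in ind_par b -> ind_sigma t = (-1) ^+ b *: t.
Proof.
move: t; apply: span_ind => [|a u v eu ev|_ [c [u [d [m [pu pm -> ->]]]]]].
- by rewrite linear0 scaler0.
- by rewrite linearP /= eu ev scalerDr !scalerA mulrC.
rewrite ind_sigmaE (usig_par pu) (sigma_par pm).
have Z1 a n v : ind_pure (a *: v) n = a *: ind_pure v n.
  have := tpurel ind_ra ind_la n a v 0; rewrite /ind_pure addr0 => ->.
  have := tpurel ind_ra ind_la n (-1) 0 0; rewrite scaler0 addr0 scaleN1r addNr => ->.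
  by rewrite addr0.
have Z2 a n v : ind_pure v (a *: n) = a *: ind_pure v n.
  have := tpurer ind_ra ind_la v a n 0; rewrite /ind_pure addr0 => ->.
  have := tpurer ind_ra ind_la v (-1) 0 0; rewrite scaler0 addr0 scaleN1r addNr => ->.
  by rewrite addr0.
by rewrite Z1 Z2 scalerA -signr_addb.
Qed.

Lemma ind_par_direct (t : ind_sort) :
  t \in ind_par false -> t \in ind_par true -> t = 0.
Proof. by move=> /ind_sigma_par e0 /ind_sigma_par; apply: direct_of_involution e0. Qed.

Lemma ind_act_par a b x t : x \in par g a -> t \in ind_par b ->
  ind_act x t \in ind_par (a (+) b).
Proof.
move=> px; move: t; apply: span_ind => [|c u v pu pv|_ [c [u [d [m [pu pm -> ->]]]]]].
- by rewrite ind_act0 rpred0.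
- by rewrite ind_act_linear; apply: rpredD pv; apply: rpredZ pu.
- by rewrite ind_actE addbA; apply: ind_pure_par => //; apply: uparM.
Qed.

(* The induced supermodule U(g) tensor_{U(h)} M. *)
Definition ind : supermodule g :=
  @SuperModule K g (SuperSpace ind_par_sum ind_par_direct) ind_act ind_rep ind_act_par.

End Induced.

Section Ideals.
Context {K : numFieldType}.

Record gradedIdeal (g : lieSuperAlg K) := GradedIdeal {
  gi_submod :> submod g;
  gi_graded : forall x, x \in gi_submod -> exists x0 x1,
    [/\ x0 \in gi_submod, x1 \in gi_submod, x0 \in par g false,
        x1 \in par g true & x = x0 + x1];
  gi_lie : forall x y, y \in gi_submod -> lie x y \in gi_submod }.

Context {g : lieSuperAlg K} (p : gradedIdeal g).

Record ideal_sort := IdealElt { ideal_val :> g; ideal_valP : ideal_val \in gi_submod p }.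
HB.instance Definition _ := [isSub for ideal_val].
HB.instance Definition _ := [Choice of ideal_sort by <:].
HB.instance Definition _ := [SubChoice_isSubLmodule of ideal_sort by <:].

Lemma ideal_val_linear : linear ideal_val. Proof. by []. Qed.

Lemma ideal_par_closed b :
  submod_closed (fun x : ideal_sort => ideal_val x \in par g b).
Proof.
split=> [|a u v]; rewrite -!topredE /=; first exact: rpred0.
by move=> pu pv; rewrite rpredD ?rpredZ.
Qed.
Definition ideal_par b : submod ideal_sort := Submod (ideal_par_closed b).

Lemma ideal_par_sum (x : ideal_sort) : exists x0 x1,
  [/\ x0 \in ideal_par false, x1 \in ideal_par true & x = x0 + x1].
Proof.
have [x0 [x1 [p0 p1 q0 q1 e]]] := gi_graded (ideal_valP x).
by exists (IdealElt p0), (IdealElt p1); split=> //; apply: val_inj.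
Qed.

Lemma ideal_par_direct (x : ideal_sort) :
  x \in ideal_par false -> x \in ideal_par true -> x = 0.
Proof. by move=> p0 p1; apply: val_inj; apply: par_direct. Qed.

(* The bracket of g restricted to g x p -> p. *)
Definition ideal_ad (x : g) (q : ideal_sort) : ideal_sort :=
  IdealElt (gi_lie x (ideal_valP q)).

Definition ideal_lie (x y : ideal_sort) : ideal_sort := ideal_ad x y.

Lemma ideal_lie_linearl y : linear (ideal_lie^~ y).
Proof. by move=> a u v; apply: val_inj; apply: lie_linearl. Qed.

Lemma ideal_lie_linearr x : linear (ideal_lie x).
Proof. by move=> a u v; apply: val_inj; apply: lie_linearr. Qed.

Lemma ideal_lie_par a b x y : x \in ideal_par a -> y \in ideal_par b ->
  ideal_lie x y \in ideal_par (a (+) b).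
Proof. exact: lie_par. Qed.

Lemma ideal_lie_skew a b x y : x \in ideal_par a -> y \in ideal_par b ->
  ideal_lie x y = - ((-1) ^+ (a && b) *: ideal_lie y x).
Proof. by move=> px py; apply: val_inj; apply: lie_skew. Qed.

Lemma ideal_lie_jacobi a b c x y z : x \in ideal_par a -> y \in ideal_par b ->
  z \in ideal_par c -> ideal_lie x (ideal_lie y z)
    = ideal_lie (ideal_lie x y) z
      + (-1) ^+ (a && b) *: ideal_lie y (ideal_lie x z).
Proof. by move=> px py pz; apply: val_inj; apply: lie_jacobi pz. Qed.

Definition ideal_lsa : lieSuperAlg K :=
  @LieSuperAlg K (SuperSpace ideal_par_sum ideal_par_direct) ideal_lie
    ideal_lie_linearl ideal_lie_linearr ideal_lie_par ideal_lie_skew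
    ideal_lie_jacobi.

Definition ideal_incl : lieSuperHom ideal_lsa g :=
  @LieSuperHom K ideal_lsa g ideal_val ideal_val_linear
    (fun _ _ px => px) (fun _ _ => erefl).

End Ideals.

Section Scalars.
Context (K : numFieldType).

Lemma scalar_par_closed b : submod_closed (fun z : K^o => b ==> (z == 0)).
Proof.
split=> [|a u v]; rewrite -!topredE /=; first by rewrite eqxx implybT.
by case: b => //= /eqP -> /eqP ->; rewrite scaler0 addr0.
Qed.
Definition scalar_par b : submod K^o := Submod (scalar_par_closed b).

Lemma scalar_par_sum (z : K^o) : exists z0 z1,
  [/\ z0 \in scalar_par false, z1 \in scalar_par true & z = z0 + z1].
Proof. by exists z, 0; rewrite addr0 rpred0. Qed.

Lemma scalar_par_direct (z : K^o) :
  z \in scalar_par false -> z \in scalar_par true -> z = 0.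
Proof. by move=> _ /eqP. Qed.

(* K as a purely even superspace. *)
Definition scalar_space : superspace K :=
  SuperSpace scalar_par_sum scalar_par_direct.

Lemma scalar_odd z : z \in par scalar_space true -> z = 0.
Proof. by move=> /eqP. Qed.

Definition scalar_lie (x y : scalar_space) : scalar_space := 0.

Lemma scalar_lie_linearl y : linear (scalar_lie^~ y).
Proof. by move=> a u v; rewrite /scalar_lie /= scaler0 addr0. Qed.
Lemma scalar_lie_linearr x : linear (scalar_lie x).
Proof. by move=> a u v; rewrite /scalar_lie scaler0 addr0. Qed.
Lemma scalar_lie_par a b x y : x \in par scalar_space a ->
  y \in par scalar_space b -> scalar_lie x y \in par scalar_space (a (+) b).
Proof. by move=> _ _; exact: rpred0. Qed.
Lemma scalar_lie_skew a b x y : x \in par scalar_space a ->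
  y \in par scalar_space b ->
  scalar_lie x y = - ((-1) ^+ (a && b) *: scalar_lie y x).
Proof. by rewrite /scalar_lie scaler0 oppr0. Qed.
Lemma scalar_lie_jacobi a b c x y z : x \in par scalar_space a ->
  y \in par scalar_space b -> z \in par scalar_space c ->
  scalar_lie x (scalar_lie y z) = scalar_lie (scalar_lie x y) z
    + (-1) ^+ (a && b) *: scalar_lie y (scalar_lie x z).
Proof. by rewrite /scalar_lie scaler0 addr0. Qed.

Definition scalar_lsa : lieSuperAlg K :=
  @LieSuperAlg K scalar_space scalar_lie scalar_lie_linearl scalar_lie_linearr
    scalar_lie_par scalar_lie_skew scalar_lie_jacobi.

End Scalars.

Section Whittaker.
Context {K : numFieldType} {g : lieSuperAlg K} {p : gradedIdeal g}.
Variable phi : lieSuperHom (ideal_lsa p) (scalar_lsa K).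

Definition whittaker_ann : set g :=
  [set y | forall q : ideal_lsa p, phi (ideal_ad y q) = 0].

Definition quasi_whittaker (V : supermodule g) : set V :=
  [set v | forall q : ideal_lsa p, act (ideal_val q) v = (phi q : K) *: v].

Definition cphi_act (q : ideal_lsa p) (z : scalar_space K) : scalar_space K :=
  (phi q : K) * (z : K).

Lemma cphi_act_par a b q z : q \in par (ideal_lsa p) a ->
  z \in par (scalar_space K) b -> cphi_act q z \in par (scalar_space K) (a (+) b).
Proof.
move=> /(lsh_par phi); rewrite /cphi_act; case: a b => [] [] //.
- by move=> /scalar_odd -> _; rewrite mul0r; exact: rpred0.
- by move=> _ /scalar_odd ->; rewrite mulr0; exact: rpred0.
Qed.

Lemma cphi_rep : is_rep cphi_act.
Proof.
rewrite /cphi_act; split=> [v a x y|x a u v|a b x y v px py].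
- by rewrite lsh_linear mulrDl -mulrA.
- by rewrite mulrDr; congr (_ + _); rewrite mulrCA.
have:= lsh_par phi px; have:= lsh_par phi py; rewrite lsh_lie mul0r.
case: a b {px py} => [] []; last 3 first.
1-3: by rewrite scale1r mulrCA subrr.
by move=> /scalar_odd -> /scalar_odd ->; rewrite !mul0r scaler0 subr0.
Qed.

(* The one-dimensional p-supermodule C w_phi; its basis vector w_phi is 1. *)
Definition cphi : supermodule (ideal_lsa p) :=
  @SuperModule K (ideal_lsa p) (scalar_space K) cphi_act cphi_rep cphi_act_par.

Definition wmod : supermodule g := ind (ideal_incl p) cphi.

Definition wphi : wmod := ind_pure (ideal_incl p) (M := cphi) 1 (1 : K).

End Whittaker.

Arguments quasi_whittaker {K g p} phi V _.

Section Monomials.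
Context {K : numFieldType} {g : lieSuperAlg K}.
Context {d : Order.disp_t} {J : orderType d} (y : J -> g).

Definition exponents : set {fsfun J -> nat with 0%N} :=
  [set be | forall j, y j \in par g true -> (be j <= 1)%N].

Definition ymon (be : {fsfun J -> nat with 0%N}) : uenv g :=
  \prod_(j <- sort >=%O (finsupp be)) uiota (y j) ^+ be j.

Definition yspan : set (uenv g) := lspan (ymon @` exponents).

End Monomials.

(* Main.v *)
From HB Require Import structures.
Require Import Defs.
From mathcomp Require Import all_boot all_order all_algebra finmap.
From mathcomp Require Import boolp classical_sets reals complex.
Import Order.TTheory GRing.Theory Num.Theory.
Set Implicit Arguments.
Unset Strict Implicit.
Unset Printing Implicit Defensive.
Local Open Scope classical_set_scope.
Local Open Scope ring_scope.

(** Write [D_q = q - phi(q)] for [q] in p, so that quasi-Whittaker vectors are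
    the common kernel of the [D_q], and let [Y] be the span of the [y^beta w].

    Straightening words in the [y_j] (a commutator of two letters lies in
    g^phi, the span of the [y_j] plus p, and p acts on such words by scalars)
    shows that [Y] is stable under g^phi and consists of quasi-Whittaker
    vectors.  Conversely, filter the module by the number of letters of g
    applied to [Y]; every [D_q] lowers the filtration degree.  Given a vector [v]
    of degree [n > 0], choose finitely many homogeneous [z_k] in g and [q_k] in
    p, of equal parities, such that [x = sum_k phi([x, q_k]) z_k] modulo g^phi
    for every letter [x] occurring in [v].  Then the Euler operator
    [E = - sum_k (-1)^|q_k| z_k D_(q_k)] multiplies [v] by [n] modulo lower
    degree.  If [v] is a quasi-Whittaker vector then [E v = 0], so [v] has
    lower degree; hence [v] lies in [Y].  Only the spanning half of the
    Poincare-Birkhoff-Witt theorem enters. *)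

(** * Linearity and supercommutation of the action on a supermodule *)

Section SuperModuleTheory.
Context {K : numFieldType} {g : lieSuperAlg K} (V : supermodule g).
Implicit Types (x y : g) (u v : V).

HB.instance Definition _ x :=
  GRing.isLinear.Build K V V *:%R (@act K g V x) (rep_linearr (act_rep V) x).

Lemma actDr x u v : act x (u + v) = act x u + act x v.
Proof. exact: linearD. Qed.

Lemma actBr x u v : act x (u - v) = act x u - act x v.
Proof. exact: linearB. Qed.

Lemma actNr x v : act x (- v) = - act x v.
Proof. exact: linearN. Qed.

Lemma actZr x a v : act x (a *: v) = a *: act x v.
Proof. exact: linearZ. Qed.

Lemma actPl v a x y : act (a *: x + y) v = a *: act x v + act y v.
Proof. exact: (rep_linearl (act_rep V)). Qed.

Lemma actDl v x y : act (x + y) v = act x v + act y v.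
Proof. by have := actPl v 1 x y; rewrite !scale1r. Qed.

Lemma act0l v : act 0 v = 0.
Proof. by apply: (addIr (act 0 v)); rewrite -actDl !add0r. Qed.

Lemma actZl v a x : act (a *: x) v = a *: act x v.
Proof. by have := actPl v a x 0; rewrite !addr0 act0l addr0. Qed.

Lemma actBl v x y : act (x - y) v = act x v - act y v.
Proof. by rewrite actDl -scaleN1r actZl scaleN1r. Qed.

Lemma act_suml (I : Type) (r : seq I) (f : I -> g) v :
  act (\sum_(i <- r) f i) v = \sum_(i <- r) act (f i) v.
Proof. exact: (big_morph _ (actDl v) (act0l v)). Qed.

Lemma act_sumr (I : Type) (r : seq I) x (f : I -> V) :
  act x (\sum_(i <- r) f i) = \sum_(i <- r) act x (f i).
Proof. exact: linear_sum. Qed.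

Lemma uact0l v : uact (@act K g V) 0 v = 0.
Proof.
have := uact_linearl (act_rep V) v (-1) 0 0.
by rewrite scaler0 addr0 scaleN1r addNr.
Qed.

Lemma uactZl a (u : uenv g) v :
  uact (@act K g V) (a *: u) v = a *: uact (@act K g V) u v.
Proof. by have := uact_linearl (act_rep V) v a u 0; rewrite uact0l !addr0. Qed.

Lemma act_swap a b x y v : x \in par g a -> y \in par g b ->
  act x (act y v) = act (lie x y) v + (-1) ^+ (a && b) *: act y (act x v).
Proof. by move=> px py; rewrite (rep_lie (act_rep V) _ px py) subrK. Qed.

End SuperModuleTheory.

(** * The pairing of g with p given by phi([x, q]), and finite dual families *)

Section WhittakerForm.
Context {K : numFieldType} {g : lieSuperAlg K} {p : gradedIdeal g}.
Variable phi : lieSuperHom (ideal_lsa p) (scalar_lsa K).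
Implicit Types (x y : g) (q : ideal_lsa p).

Definition chr q : K := phi q.

Lemma chr_linear : scalar chr.
Proof. exact: (lsh_linear phi). Qed.
HB.instance Definition _ :=
  GRing.isLinear.Build K (ideal_lsa p) K *%R chr chr_linear.

Lemma chr_odd q : q \in par (ideal_lsa p) true -> chr q = 0.
Proof. by move=> /(lsh_par phi)/scalar_odd. Qed.

Definition wform x q : K := chr (ideal_ad x q).

Lemma wform_linearl q : scalar (wform^~ q).
Proof.
move=> a x y; rewrite /wform -chr_linear; congr chr; apply: val_inj.
exact: lie_linearl.
Qed.

Lemma wform_linearr x : scalar (wform x).
Proof.
move=> a q r; rewrite /wform -chr_linear; congr chr; apply: val_inj.
exact: lie_linearr.
Qed.
HB.instance Definition _ x :=
  GRing.isLinear.Build K (ideal_lsa p) K *%R (wform x) (wform_linearr x).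

(** Named version of the pairing in its first slot, so that this slot can also carry a linear
    structure. *)
Definition wforml q := wform^~ q.
HB.instance Definition _ q :=
  GRing.isLinear.Build K g K *%R (wforml q) (wform_linearl q).
Lemma wformlE x q : wform x q = wforml q x. Proof. by []. Qed.

Lemma wform_par a b x q : x \in par g a -> q \in par (ideal_lsa p) b ->
  a != b -> wform x q = 0.
Proof.
move=> px pq ab; apply: chr_odd; have : ideal_val (ideal_ad x q) \in par g (a (+) b).
  exact: lie_par.
by case: a b ab {px pq} => [] [].
Qed.

Lemma annP x : whittaker_ann phi x <-> forall q, wform x q = 0.
Proof. by []. Qed.

(** By the Jacobi identity [[x, y], q] is a combination of [x, [y, q]] and [y, [x, q]]. The inner
    brackets lie in p because p is an ideal, so phi kills both terms. *)
Lemma ann_lie a b x y : x \in par g a -> y \in par g b ->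
  whittaker_ann phi x -> whittaker_ann phi y -> whittaker_ann phi (lie x y).
Proof.
move=> px py /annP hx /annP hy; apply/annP => q.
have [q0 [q1 [p0 p1 ->]]] := par_sum q.
have H c r : r \in par (ideal_lsa p) c -> wform (lie x y) r = 0.
  move=> pr; have := hx (ideal_ad y r); rewrite /wform.
  have -> : ideal_ad x (ideal_ad y r) = ideal_ad (lie x y) r
      + (-1) ^+ (a && b) *: ideal_ad y (ideal_ad x r).
    by apply: val_inj; apply: (lie_jacobi px py (pr : ideal_val r \in par g c)).
  rewrite linearD linearZ /= -[X in _ + _ * X]/(wform y (ideal_ad x r)) hy.
  by rewrite mulr0 addr0.
by rewrite linearD /= (H false) // (H true) // addr0.
Qed.

(* Each entry [(a, z, q)] records the common parity [a] of [z] and [q]. *)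
Definition cofamily := seq (bool * g * ideal_lsa p).

Definition cohomog (F : cofamily) : Prop := forall k, k \in F ->
  k.1.2 \in par g k.1.1 /\ k.2 \in par (ideal_lsa p) k.1.1.

Definition coexpand (F : cofamily) x : g :=
  \sum_(k <- F) wform x k.2 *: k.1.2.

Lemma coexpand_par F a x : cohomog F -> x \in par g a -> coexpand F x \in par g a.
Proof.
move=> hF px; rewrite /coexpand big_seq rpred_sum // => k /hF [pz pq].
have [e|ne] := eqVneq a k.1.1; first by rewrite rpredZ // e.
by rewrite (wform_par px pq ne) scale0r rpred0.
Qed.

(* If the residue [x - coexpand F x] is not annihilated, pairing it with a
   suitable [q] and subtracting that rank-one term kills the residue of [x]
   without affecting the vectors whose residue already lies in g^phi. *)
Lemma cofamily_exists (s : seq (bool * g)) :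
  (forall k, k \in s -> k.2 \in par g k.1) ->
  exists2 F, cohomog F &
    forall k, k \in s -> whittaker_ann phi (k.2 - coexpand F k.2).
Proof.
elim: s => [|[a x] s IH] hs; first by exists [::].
have [k ks|F hF FP] := IH; first by apply: hs; rewrite inE ks orbT.
have px : x \in par g a by apply: (hs (a, x)); rewrite mem_head.
set z := x - coexpand F x.
have pz : z \in par g a by rewrite rpredB // coexpand_par.
have [zH|/existsNP [q0 nz]] := pselect (whittaker_ann phi z).
  by exists F => // k; rewrite inE => /predU1P [->|/FP].
(* Since [z] has parity [a], it pairs to zero with the component of [q0] of the other parity. *)
have [q pq wq] : exists2 q, q \in par (ideal_lsa p) a & wform z q != 0.
  have [r0 [r1 [p0 p1 e]]] := par_sum q0.
  have nz' : wform z r0 + wform z r1 != 0 by rewrite -linearD -e; apply/eqP.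
  case: a pz {px hs} => pz; [exists r1 => //|exists r0 => //].
    by move: nz'; rewrite (wform_par pz p0) // add0r.
  by move: nz'; rewrite (wform_par pz p1) // addr0.
have [q1 pq1 wq1] : exists2 q1, q1 \in par (ideal_lsa p) a & wform z q1 = 1.
  exists ((wform z q)^-1 *: q); first by rewrite rpredZ.
  by rewrite linearZ /= mulVf.
(* This correction makes [q'] pair with any u as [q1] pairs with the residue of u, so the enlarged
   family subtracts a rank-one term from that residue. *)
pose q' := q1 - \sum_(k <- F) wform k.1.2 q1 *: k.2.
have pq' : q' \in par (ideal_lsa p) a.
  rewrite rpredB // big_seq rpred_sum // => k /hF [pzk pqk].
  have [e|ne] := eqVneq k.1.1 a; first by rewrite rpredZ // -e.
  by rewrite (wform_par pzk pq1 ne) scale0r rpred0.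
have key u : u - coexpand ((a, z, q') :: F) u
    = (u - coexpand F u) - wform (u - coexpand F u) q1 *: z.
  rewrite {1}/coexpand big_cons /= -/(coexpand F u) opprD addrA addrAC.
  congr (_ - _ *: _).
  rewrite linearB /= [in RHS]wformlE linearB /= -wformlE; congr (_ - _).
  rewrite /coexpand !linear_sum; apply: eq_bigr => k _.
  by rewrite !linearZ /= mulrC.
exists ((a, z, q') :: F) => [k|k].
  by rewrite inE => /predU1P [->|/hF].
rewrite inE => /predU1P [->|ks]; rewrite key /=.
  by rewrite -/z wq1 scale1r subrr; apply/annP => r; rewrite wformlE linear0.
have /annP kH := FP _ ks.
by rewrite kH scale0r subr0; apply/annP.
Qed.

End WhittakerForm.

Arguments cofamily {K g} p.

(** * The letter filtration over Y and descent by the Euler operator *)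

Section Descent.
Context {K : numFieldType} {g : lieSuperAlg K} {p : gradedIdeal g}.
Variables (phi : lieSuperHom (ideal_lsa p) (scalar_lsa K)) (V : supermodule g).
Implicit Types (x y : g) (q : ideal_lsa p) (v : V) (n : nat).

Definition defect q v : V := act (ideal_val q) v - chr phi q *: v.

Lemma defect_linear q : linear (defect q).
Proof.
move=> a u v; rewrite /defect linearP scalerBr scalerDr !scalerA [_ * a]mulrC.
by rewrite opprD addrACA.
Qed.
HB.instance Definition _ q :=
  GRing.isLinear.Build K V V *:%R (defect q) (defect_linear q).

Lemma defectDl q r v : defect (q + r) v = defect q v + defect r v.
Proof.
by rewrite /defect linearD /= scalerDl (actDl v (ideal_val q)) opprD addrACA.
Qed.

Lemma quasi_whittakerP v :
  quasi_whittaker phi V v <-> forall q, defect q v = 0.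
Proof.
split=> vP q; first by rewrite /defect vP subrr.
by apply/eqP; rewrite -subr_eq0; apply/eqP/vP.
Qed.

(** Solve [x, q] = x q - (-1)^(ab) q x for q x, and split the action of [x, q] into its defect and
    the scalar phi([x, q]). *)
Lemma defect_act a b x q v : x \in par g a -> q \in par (ideal_lsa p) b ->
  defect q (act x v) = (-1) ^+ (a && b) *:
    (act x (defect q v) - defect (ideal_ad x q) v - wform phi x q *: v).
Proof.
move=> px pq; have sK (u : V) : (-1) ^+ (a && b) *: ((-1) ^+ (a && b) *: u) = u.
  by rewrite scalerA -signr_addb addbb scale1r.
(* The sign is -1 only for odd [q], where phi vanishes. *)
have sq : (-1) ^+ (a && b) * chr phi q = chr phi q.
  by case: b pq {sK} => [/(chr_odd phi)->|_]; rewrite ?mulr0 // andbF mul1r.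
have e : defect (ideal_ad x q) v + wform phi x q *: v = act (lie x (ideal_val q)) v.
  by rewrite /defect /wform subrK.
rewrite -addrA -opprD e (rep_lie (act_rep V) _ px pq) /defect actBr actZr.
by rewrite opprB addrC addrA subrK scalerBr sK scalerA sq.
Qed.

(** Every term on the right of [defect_act] vanishes. *)
Lemma quasi_whittaker_act a x v : x \in par g a -> whittaker_ann phi x ->
  quasi_whittaker phi V v -> quasi_whittaker phi V (act x v).
Proof.
move=> px /annP xH /quasi_whittakerP vP; apply/quasi_whittakerP => q.
have [q0 [q1 [p0 p1 ->]]] := par_sum q.
by rewrite defectDl (defect_act v px p0) (defect_act v px p1) !vP !xH linear0
  !subr0 scale0r !subr0 !scaler0 addr0.
Qed.

Variable Y : submod V.
Hypothesis YW : forall v, v \in Y -> quasi_whittaker phi V v.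
Hypothesis YH : forall x v, whittaker_ann phi x -> v \in Y -> act x v \in Y.

(* The filtration is shifted: [layer 0 = 0] and [layer 1 = Y]. *)
Fixpoint layer n : submod V :=
  if n is n'.+1 then spanS [set t | t \in Y \/
    exists a x v, [/\ x \in par g a, v \in layer n' & t = act x v]]
  else spanS set0.
Arguments layer : simpl never.

Lemma layer0 v : v \in layer 0 -> v = 0.
Proof.
by move: v; apply: span_ind => // a u v -> ->; rewrite scaler0 addr0.
Qed.

Lemma sub_layer n v : v \in Y -> v \in layer n.+1.
Proof. by move=> vY; apply: span_gen; left. Qed.

Lemma act_layer n x v : v \in layer n -> act x v \in layer n.+1.
Proof.
move=> vn; have [x0 [x1 [p0 p1 ->]]] := par_sum x; rewrite actDl.
by apply: rpredD; apply: span_gen; right; [exists false, x0, v|exists true, x1, v].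
Qed.

Lemma layer_ind n (P : V -> Prop) : P 0 ->
  (forall a u v, P u -> P v -> P (a *: u + v)) ->
  (forall v, v \in Y -> P v) ->
  (forall a x v, x \in par g a -> v \in layer n -> P (act x v)) ->
  forall v, v \in layer n.+1 -> P v.
Proof.
move=> P0 PP PY Pact; apply: span_ind => // v [/PY //|[a [x [u [px un ->]]]]].
exact: Pact px un.
Qed.

Lemma layerS n v : v \in layer n -> v \in layer n.+1.
Proof.
elim: n v => [v /layer0 ->|n IH]; first exact: rpred0.
apply: layer_ind => [|a u v un vn|v vY|a x v px /IH vn].
- exact: rpred0.
- by rewrite rpredD ?rpredZ.
- exact: sub_layer.
- exact: act_layer.
Qed.

Lemma layer_mono m n v : (m <= n)%N -> v \in layer m -> v \in layer n.
Proof.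
by move=> /subnK <- vm; elim: (n - m)%N => // k; rewrite addSn => /layerS.
Qed.

Lemma layer_pred n v : v \in layer n.-1 -> v \in layer n.
Proof. exact/layer_mono/leq_pred. Qed.

(** Moving the defect past a letter leaves defects of the shorter vector and a scalar multiple of
    it, so one letter is lost. At the bottom, [Y] has no defect. *)
Lemma defect_layer n q v : v \in layer n -> defect q v \in layer n.-1.
Proof.
elim: n q v => [q v /layer0 -> |n IH q]; first by rewrite linear0 rpred0.
apply: layer_ind => [|a u v un vn|v vY|a x v px vn].
- by rewrite linear0 rpred0.
- by rewrite linearP /= rpredD ?rpredZ.
- by have /quasi_whittakerP -> := YW vY; apply: rpred0.
have H b r : r \in par (ideal_lsa p) b -> defect r (act x v) \in layer n.
  move=> pr; rewrite (defect_act v px pr) rpredZ //.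
  apply: rpredB; last exact: rpredZ.
  apply: rpredB; last exact: (layer_pred (IH _ _ vn)).
  (* The predecessor truncates at 0, where [act_layer] would overshoot; there [v] is 0. *)
  case: n IH vn => [_ /layer0 ->|n IH vn]; first by rewrite !linear0 rpred0.
  exact/act_layer/(IH r).
have [q0 [q1 [p0 p1 ->]]] := par_sum q.
by rewrite defectDl; apply: rpredD; [apply: (H false)|apply: (H true)].
Qed.

(** Moving [x] inward past a letter y costs only the replacement of y by the single letter [x, y];
    on [Y] the claim is [YH]. *)
Lemma ann_layer n a x v : x \in par g a -> whittaker_ann phi x ->
  v \in layer n -> act x v \in layer n.
Proof.
move=> px xH; elim: n v => [v /layer0 ->|n IH]; first by rewrite linear0 rpred0.
apply: layer_ind => [|c u v un vn|v vY|b y v py vn].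
- by rewrite linear0 rpred0.
- by rewrite actDr actZr rpredD ?rpredZ.
- exact/sub_layer/YH.
- by rewrite (act_swap v px py) rpredD ?rpredZ ?act_layer ?IH.
Qed.

Definition euler (F : cofamily p) v : V :=
  - \sum_(k <- F) (-1) ^+ k.1.1 *: act k.1.2 (defect k.2 v).

Lemma euler_linear F : linear (euler F).
Proof.
move=> a u v; rewrite /euler scalerN -opprD scaler_sumr -big_split /=.
congr (- _); apply: eq_bigr => k _.
by rewrite defect_linear actDr actZr scalerDr !scalerA mulrC.
Qed.
HB.instance Definition _ F :=
  GRing.isLinear.Build K V V *:%R (euler F) (euler_linear F).

(* Up to lower layers, [euler F] is an even derivation sending a letter [x]
   to [coexpand phi F x]. *)
Lemma euler_act F n a x v : cohomog F -> x \in par g a -> v \in layer n.+1 ->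
  euler F (act x v) - act (coexpand phi F x) v - act x (euler F v)
    \in layer n.+1.
Proof.
move=> hF px vn; rewrite /euler /coexpand act_suml.
rewrite actNr opprK act_sumr -opprD -big_split -sumrN -big_split.
rewrite big_seq; apply: rpred_sum => -[[b z] q] /hF /= [pz pq].
rewrite -[_ \in _]/(_ \in layer n.+1).
rewrite (defect_act v px pq) actZl.
set s := (-1) ^+ (a && b); set D := defect q v.
have ss : s * s = 1 by rewrite -signr_addb addbb.
(* The pairing is zero unless a = b, and then the two signs cancel. *)
have sw : (-1) ^+ b * s * wform phi x q = wform phi x q.
  have [ab|ne] := eqVneq a b; last by rewrite (wform_par phi px pq ne) mulr0.
  by rewrite /s ab andbb -signr_addb addbb mul1r.
(* Here t is D_q v and u is D_[x,q] v. The scalar terms cancel against [coexpand], and z x t against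
   x z t up to a bracket; t and u are both one layer down. *)
have key (t u : V) :
    - ((-1) ^+ b *: act z (s *: (act x t - u - wform phi x q *: v))
       + wform phi x q *: act z v) + act x ((-1) ^+ b *: act z t)
    = (-1) ^+ b *: (s *: (act z u - act (lie z x) t)).
  rewrite !actZr !actBr actZr (act_swap t pz px) andbC -/s.
  rewrite !scalerBr !scalerDr !scalerA sw -mulrA ss mulr1 !opprD !opprK.
  by rewrite addrK addrAC subrK addrC.
rewrite key.
have Dn : D \in layer n by apply: (defect_layer q vn).
apply: rpredZ; apply: rpredZ; apply: rpredB; last exact: act_layer.
exact/act_layer/(defect_layer _ vn).
Qed.

Lemma euler_quasi_whittaker F v : quasi_whittaker phi V v -> euler F v = 0.
Proof.
move=> /quasi_whittakerP vP; rewrite /euler big1 ?oppr0 // => k _.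
by rewrite vP linear0 scaler0.
Qed.

(** Fixing the letters [s] before quantifying over [F] lets the summands of a linear combination
    share one family, by concatenating their lists. Because of the shifted filtration, the
    eigenvalue on [layer n.+1] is n. *)
Lemma euler_layer n v : v \in layer n.+1 -> exists2 s : seq (bool * g),
  forall k, k \in s -> k.2 \in par g k.1 &
  forall F, cohomog F ->
    (forall k, k \in s -> whittaker_ann phi (k.2 - coexpand phi F k.2)) ->
    euler F v - n%:R *: v \in layer n.
Proof.
elim: n v => [|n IH]; apply: layer_ind => [|a u v|v vY|a x v px vn].
1,5: by exists [::] => // F _ _; rewrite linear0 scaler0 subr0 rpred0.
1,4: move=> [s hs sP] [t ht tP]; exists (s ++ t) => [k|F hF FP];
  [by rewrite mem_cat => /orP [/hs|/ht]|];
  rewrite euler_linear scalerDr scalerA mulrC -scalerA opprD addrACA -scalerBr;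
  apply: rpredD; [apply/rpredZ/sP|apply: tP] => // k ks; apply: FP;
  by rewrite mem_cat ks ?orbT.
- exists [::] => // F _ _; rewrite (euler_quasi_whittaker F (YW vY)).
  by rewrite scale0r subr0 rpred0.
- exists [::] => // F _ _; have -> : act x v = 0 by rewrite (layer0 vn) linear0.
  by rewrite linear0 scaler0 subr0 rpred0.
- exists [::] => // F _ _; rewrite (euler_quasi_whittaker F (YW vY)) sub0r.
  by rewrite rpredN rpredZ // sub_layer.
have [s hs sP] := IH v vn; exists ((a, x) :: s) => [k|F hF FP].
  by rewrite inE => /predU1P [->|/hs].
have {}sP : euler F v - n%:R *: v \in layer n.
  by apply: sP => // k ks; apply: FP; rewrite inE ks orbT.
have xH : whittaker_ann phi (x - coexpand phi F x).
  by apply: (FP (a, x)); rewrite mem_head.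
have px' : x - coexpand phi F x \in par g a by rewrite rpredB ?coexpand_par.
have -> : euler F (act x v) - n.+1%:R *: act x v =
    (euler F (act x v) - act (coexpand phi F x) v - act x (euler F v))
    - act (x - coexpand phi F x) v + act x (euler F v - n%:R *: v).
  (* The three errors are the failure of the Leibniz rule, the residue of [x] in g^phi, and the
     inductive error for [v]. *)
  have key (e c t u m : V) : e - (m + u) = e - c - t - (u - c) + (t - m).
    rewrite opprB [e - c - t]addrAC [_ - c + _]addrA subrK [e - t - u]addrAC.
    by rewrite [_ - t + _]addrA subrK -addrA opprD [- u - m]addrC.
  by rewrite actBl actBr actZr -key -natr1 scalerDl scale1r.
apply: rpredD; last exact: act_layer.
apply: rpredB; last exact: ann_layer px' xH vn.
exact: euler_act hF px vn.
Qed.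

(** The Euler operator kills [v] and is n + 1 modulo the lower layer, and n + 1 is invertible in
    characteristic 0. *)
Lemma quasi_whittaker_layer n v :
  quasi_whittaker phi V v -> v \in layer n.+2 -> v \in layer n.+1.
Proof.
move=> vP /euler_layer [s hs sP].
have [F hF FP] := cofamily_exists phi hs.
have := sP F hF FP; rewrite (euler_quasi_whittaker F vP) sub0r rpredN => vn.
by rewrite -[v](scalerK (_ : n.+1%:R != 0 :> K)) ?pnatr_eq0 // rpredZ.
Qed.

Lemma quasi_whittaker_sub v :
  (exists n, v \in layer n) -> quasi_whittaker phi V v -> v \in Y.
Proof.
move=> [n vn] vP; suff : v \in layer 1.
  move: v {vn vP}; apply: layer_ind => // [|a u w uY wY|a x u _ /layer0 ->].
  - exact: rpred0.
  - by rewrite rpredD ?rpredZ.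
  - by rewrite linear0 rpred0.
elim: n vn => [/layer0 ->|[//|n] IH vn]; first exact: rpred0.
exact/IH/(quasi_whittaker_layer vP).
Qed.

End Descent.

(** * Straightening words in the y_j into ordered monomials *)

Section Straightening.
Context {K : numFieldType} {g : lieSuperAlg K} {p : gradedIdeal g}.
Variables (phi : lieSuperHom (ideal_lsa p) (scalar_lsa K)) (V : supermodule g).
Context {d : Order.disp_t} {J : orderType d} (y : J -> g).
Variable w : V.
Hypothesis y_homog : forall j, homogeneous (y j).
Hypothesis y_ann : forall j, whittaker_ann phi (y j).
Hypothesis y_span : forall x, whittaker_ann phi x ->
  exists2 z, z \in spanS (range y) & x - z \in p.
Hypothesis w_qw : quasi_whittaker phi V w.
Implicit Types (n : nat) (s t : seq J) (v : V).

Definition yword s : V := foldr (fun j => act (y j)) w s.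

Definition words n : submod V :=
  spanS [set v | exists s, (size s <= n)%N /\ v = yword s].

Lemma yword_in n s : (size s <= n)%N -> yword s \in words n.
Proof. by move=> sn; apply: span_gen; exists s. Qed.

Lemma words_mono m n v : (m <= n)%N -> v \in words m -> v \in words n.
Proof.
move=> mn; move: v; apply: span_ind => [|a u u'|_ [s [sm ->]]].
- exact: rpred0.
- by move=> un u'n; rewrite rpredD ?rpredZ.
- exact/yword_in/(leq_trans sm).
Qed.

Lemma yword_quasi_whittaker s : quasi_whittaker phi V (yword s).
Proof.
elim: s => //= j s IH; have [b pj] := y_homog j.
exact: quasi_whittaker_act pj (y_ann j) IH.
Qed.

Lemma words_quasi_whittaker n v : v \in words n -> quasi_whittaker phi V v.
Proof.
move=> vn; apply/quasi_whittakerP => q; move: v vn.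
apply: span_ind => [|a u v eu ev|_ [s [_ ->]]].
- exact: linear0.
- by rewrite linearP /= eu ev scaler0 addr0.
- by have /quasi_whittakerP := yword_quasi_whittaker s.
Qed.

Lemma y_words n j v : v \in words n -> act (y j) v \in words n.+1.
Proof.
move: v; apply: span_ind => [|a u v un vn|_ [s [sn ->]]].
- by rewrite linear0 rpred0.
- by rewrite actDr actZr rpredD ?rpredZ.
- exact: (@yword_in n.+1 (j :: s)).
Qed.

(** Modulo p, [x] is a combination of the y_j, each adding one letter; the remainder in p acts by a
    scalar, as words are quasi-Whittaker vectors. *)
Lemma ann_words n x v : whittaker_ann phi x -> v \in words n ->
  act x v \in words n.+1.
Proof.
move=> /y_span [z zy xz] vn; rewrite -[x](subrK z) actDl rpredD //.
  have := words_quasi_whittaker vn (IdealElt xz).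
  move=> /(congr1 (fun u => u \in words n.+1)) ->.
  by rewrite rpredZ // (words_mono (leqnSn n)).
move: z zy {xz}; apply: span_ind => [|a u u' un u'n|_ [j _ <-]].
- by rewrite act0l rpred0.
- by rewrite actPl rpredD ?rpredZ.
- exact: y_words.
Qed.

(** Congruence up to an unspecified sign modulo short words: exchanging odd letters changes signs,
    which do not affect spans. *)
Definition eqw n u v := exists b : bool, u - (-1) ^+ b *: v \in words n.

Lemma eqw_refl n u : eqw n u u.
Proof. by exists false; rewrite scale1r subrr rpred0. Qed.

Lemma eqw_trans n v u r : eqw n u v -> eqw n v r -> eqw n u r.
Proof.
move=> [b uv] [c vt]; exists (b (+) c).
have -> : u - (-1) ^+ (b (+) c) *: r =
    (u - (-1) ^+ b *: v) + (-1) ^+ b *: (v - (-1) ^+ c *: r).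
  by rewrite scalerBr scalerA -signr_addb addrA subrK.
by rewrite rpredD ?rpredZ.
Qed.

Lemma eqw_act n j u v : eqw n u v -> eqw n.+1 (act (y j) u) (act (y j) v).
Proof. by move=> [b uv]; exists b; rewrite -actZr -actBr y_words. Qed.

(** The bracket [y_i, y_j] lies in g^phi, so by [ann_words] it lengthens [s] by one letter instead
    of two. *)
Lemma yword_swap i j s :
  eqw (size s).+1 (yword [:: i, j & s]) (yword [:: j, i & s]).
Proof.
have [a pi] := y_homog i; have [b pj] := y_homog j; exists (a && b).
rewrite /= (act_swap _ pi pj) addrK; apply: ann_words; last exact: yword_in.
exact: (ann_lie pi pj).
Qed.

Lemma yword_insert i s t :
  eqw (size (s ++ t)) (yword (i :: s ++ t)) (yword (s ++ i :: t)).
Proof.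
elim: s => [|j s IH]; first exact: eqw_refl.
exact: eqw_trans (yword_swap i j (s ++ t)) (eqw_act j IH).
Qed.

Lemma yword_perm s t : perm_eq s t -> eqw (size s).-1 (yword s) (yword t).
Proof.
elim: s t => [|i s IH] t st.
  by have -> : t = [::] by [apply/perm_nilP; rewrite perm_sym]; apply: eqw_refl.
have it : i \in t by rewrite -(perm_mem st) mem_head.
case/splitPr: it st => t1 t2; rewrite -[i :: t2]cat1s perm_sym perm_catCA perm_cons => st.
have e : size s = size (t1 ++ t2) by rewrite (perm_size st).
(* First permute the tail behind [i], then carry [i] to its place in [t]. *)
apply: eqw_trans (_ : eqw _ _ (yword (i :: t1 ++ t2))) _; last first.
  by rewrite /= e; apply: yword_insert.
(* For an empty tail the truncated bound leaves no room for [eqw_act], but the two words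
   coincide. *)
case: s IH st e => [|k s] IH st e.
  by move: st => /perm_nilP ->; apply: eqw_refl.
by apply: eqw_act; apply: IH; rewrite perm_sym.
Qed.

(** For odd y_j, twice its square is [y_j, y_j], an element of g^phi. *)
Lemma yword_odd_sqr j s : y j \in par g true ->
  yword [:: j, j & s] \in words (size s).+1.
Proof.
move=> pj.
have e : 2%:R *: yword [:: j, j & s] = act (lie (y j) (y j)) (yword s).
  rewrite scaler_nat mulr2n [X in X + _](act_swap _ pj pj).
  by rewrite expr1 scaleN1r subrK.
rewrite -[yword _](scalerK (_ : 2%:R != 0 :> K)) ?pnatr_eq0 // e rpredZ //.
by apply: ann_words; [apply: (ann_lie pj pj)|apply: yword_in].
Qed.

Lemma uact_prod_yword s :
  uact (@act K g V) (\prod_(j <- s) uiota (y j)) w = yword s.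
Proof.
elim: s => [|j s IH]; first by rewrite big_nil (uact1 (act_rep V)).
by rewrite big_cons (uactM (act_rep V)) IH (uact_uiota (act_rep V)).
Qed.

Lemma uact_ymon (be : {fsfun J -> nat with 0%N}) : uact (@act K g V) (ymon y be) w
  = yword (flatten [seq nseq (be j) j | j <- sort >=%O (finsupp be)]).
Proof.
rewrite -uact_prod_yword big_flatten big_map /ymon; congr uact.
by apply: eq_bigr => j _; rewrite big_nseq -Monoid.iteropE /=.
Qed.

Definition ysub : submod V := spanS
  ((fun u => uact (@act K g V) u w) @` (ymon y @` exponents y)).

Lemma ysubP v : v \in ysub <-> exists2 u, yspan y u & uact (@act K g V) u w = v.
Proof.
split=> [|[u /spanSP uy <-]].
  move: v; apply: span_ind => [|a _ _ [u uy <-] [u' u'y <-]|_ [u uy <-]].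
  - exists 0; first exact/spanSP/rpred0.
    exact: uact0l.
  - exists (a *: u + u'); last exact: (uact_linearl (act_rep V)).
    by apply/spanSP; rewrite rpredD ?rpredZ //; apply/spanSP.
  - by exists u => //; apply/spanSP/span_gen.
move: u uy; apply: span_ind => [|a u u' un u'n|u uy].
- by rewrite uact0l rpred0.
- by rewrite (uact_linearl (act_rep V)) rpredD ?rpredZ.
- by apply: span_gen; exists u.
Qed.

Definition mult s : {fsfun J -> nat with 0%N} :=
  [fsfun j in [fset i in s]%fset => count_mem j s | 0%N].

Lemma multE s j : mult s j = count_mem j s.
Proof.
rewrite fsfunE inE; case: ifP => // /negbT.
by rewrite -has_pred1 has_count lt0n negbK => /eqP.
Qed.

Lemma perm_mult s :
  perm_eq s (flatten [seq nseq (mult s j) j | j <- sort >=%O (finsupp (mult s))]).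
Proof.
rewrite perm_sym; apply: perm_trans (perm_count_undup s).
rewrite (eq_map (fun j => congr1 (nseq^~ j) (multE s j))).
apply/perm_flatten/perm_map; rewrite perm_sort; apply: uniq_perm.
- exact: fset_uniq.
- exact: undup_uniq.
by move=> j; rewrite mem_undup mem_finsupp multE -lt0n -has_count has_pred1.
Qed.

(** Induction on length: a word with a repeated odd letter becomes shorter once two copies are
    adjacent; any other word is, up to sign and shorter words, the ordered monomial of its
    multiplicities. *)
Lemma words_ysub n v : v \in words n -> v \in ysub.
Proof.
elim: n v => [|n IH]; apply: span_ind => [|a u v un vn|_ [s [sn ->]]].
1,4: exact: rpred0.
1,3: by rewrite rpredD ?rpredZ.
  have -> : s = [::] by case: s sn.
  have -> : yword [::] = uact (@act K g V) (ymon y (mult [::])) w.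
    rewrite uact_ymon; congr yword; apply/esym/perm_nilP.
    by rewrite perm_sym perm_mult.
  apply: span_gen; exists (ymon y (mult [::])) => //; exists (mult [::]) => //.
  by move=> j _; rewrite multE.
have sz m : (m <= (size s).-1)%N -> {subset words m <= ysub}.
  move=> ms u um; apply: IH; apply: words_mono um; apply: leq_trans ms _.
  by case: (size s) sn.
have [[j [pj cj]]|nex] :=
  pselect (exists j, y j \in par g true /\ (1 < count_mem j s)%N).
  have js : j \in s by rewrite -has_pred1 has_count (ltn_trans _ cj).
  have st : perm_eq s [:: j, j & rem j (rem j s)].
    apply: perm_trans (perm_to_rem js) _; rewrite perm_cons perm_to_rem //.
    rewrite -has_pred1 has_count -(ltn_add2l 1).
    by have /permP /(_ (pred1 j)) := perm_to_rem js; rewrite /= eqxx => <-.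
  have [b hb] := yword_perm st.
  rewrite -[yword s](subrK ((-1) ^+ b *: yword [:: j, j & rem j (rem j s)])).
  apply: rpredD; first exact: sz hb.
  apply/rpredZ/(sz _ _ _ (yword_odd_sqr _ pj)).
  by rewrite (perm_size st).
have [b hb] := yword_perm (perm_mult s).
rewrite -uact_ymon in hb.
rewrite -[yword s](subrK ((-1) ^+ b *: uact (@act K g V) (ymon y (mult s)) w)).
apply: rpredD; first exact: sz hb.
apply/rpredZ/span_gen; exists (ymon y (mult s)) => //.
exists (mult s) => // j pj; rewrite multE leqNgt; apply/negP => cj.
by apply: nex; exists j.
Qed.

Lemma ysub_words v : v \in ysub -> exists n, v \in words n.
Proof.
move: v; apply: span_ind => [|a u v [m um] [n vn]|_ [_ [be _ <-] <-]].
- by exists 0%N; apply: rpred0.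
- exists (maxn m n); rewrite rpredD ?rpredZ //.
    exact: words_mono (leq_maxl m n) um.
  exact: words_mono (leq_maxr m n) vn.
- by rewrite uact_ymon; eexists; apply: yword_in (leqnn _).
Qed.

Lemma ysub_quasi_whittaker v : v \in ysub -> quasi_whittaker phi V v.
Proof. by move=> /ysub_words [n /words_quasi_whittaker]. Qed.

Lemma ysub_ann x v : whittaker_ann phi x -> v \in ysub -> act x v \in ysub.
Proof.
by move=> xH /ysub_words [n vn]; apply: (@words_ysub n.+1); apply: ann_words.
Qed.

Lemma ysub_gen : w \in ysub.
Proof. by apply: (@words_ysub 0); apply: (yword_in (leqnn (size [::]))). Qed.

Lemma quasi_whittaker_cyclic :
  (forall v, exists u, v = uact (@act K g V) u w) ->
  quasi_whittaker phi V = [set uact (@act K g V) u w | u in yspan y].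
Proof.
move=> wgen; apply/seteqP; split=> v vP; last first.
  exact/ysub_quasi_whittaker/ysubP.
apply/ysubP; apply: (quasi_whittaker_sub ysub_quasi_whittaker ysub_ann) vP.
(* The layers exhaust the module: [w] lies in [layer 1], and each generator of U(g) raises the index
   by one. *)
have [u ->] := wgen v; move: u {v wgen}.
apply: uenv_indP => [|a u v [m um] [n vn]|x u [n un]].
- by exists 1%N; rewrite (uact1 (act_rep V)); apply/sub_layer/ysub_gen.
- exists (maxn m n); rewrite (uact_linearl (act_rep V)) rpredD ?rpredZ //.
    exact: layer_mono (leq_maxl m n) um.
  exact: layer_mono (leq_maxr m n) vn.
- exists n.+1; rewrite (uactM (act_rep V)) (uact_uiota (act_rep V)).
  exact: act_layer.
Qed.

End Straightening.

(** * The universal module W(phi) and lifting of the basis *)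

Section WhittakerModule.
Context {K : numFieldType} {g : lieSuperAlg K} {p : gradedIdeal g}.
Variable phi : lieSuperHom (ideal_lsa p) (scalar_lsa K).

Lemma ind_pure1Z u (a : K) :
  ind_pure (ideal_incl p) (M := cphi phi) u a
    = a *: ind_pure (ideal_incl p) (M := cphi phi) u (1 : K).
Proof.
pose la := @ind_la K (ideal_lsa p) (cphi phi).
have := tpurer (ind_ra (ideal_incl p)) la u a (1 : K) (0 : K).
(* Linearity with coefficient -1 at zero vectors gives u tensor 0 = 0. *)
have := tpurer (ind_ra (ideal_incl p)) la u (-1) (0 : K) (0 : K).
rewrite scaler0 addr0 scaleN1r addNr => ->; rewrite !addr0 => <-.
by rewrite [_ *: (1 : K^o)]mulr1.
Qed.

(** An element of p moves across the tensor sign over U(p) and then acts on C w_phi through phi. *)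
Lemma wphi_quasi_whittaker : quasi_whittaker phi (wmod phi) (wphi phi).
Proof.
move=> q; rewrite -[LHS]/(ind_act (ideal_val q) (wphi phi)) /wphi ind_actE mulr1.
rewrite -[ideal_val q]/(ideal_incl p q) -umap_uiota -[umap _ _]mul1r.
rewrite -ind_pure1Z /ind_pure.
rewrite -[_ * _]/(ind_ra (ideal_incl p) 1 (uiota q)) tpure_bal; congr tpure.
by rewrite /ind_la (uact_uiota (cphi_rep phi)) /cphi_act mulr1.
Qed.

(** The second factor is one-dimensional, so u tensor m is (m u) w_phi. *)
Lemma wphi_cyclic (v : wmod phi) :
  exists u, v = uact (@act _ _ (wmod phi)) u (wphi phi).
Proof.
move: v; apply: tens_ind => [|a _ _ [u ->] [u' ->]|u m].
- by exists 0; rewrite uact0l.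
- by exists (a *: u + u'); rewrite (uact_linearl (act_rep (wmod phi))).
exists ((m : K) *: u); rewrite uactZl.
have := uact_ind (ideal_incl p) (M := cphi phi) u 1 (1 : K).
rewrite mulr1 => e; rewrite -[LHS]/(ind_pure (ideal_incl p) (M := cphi phi) u m).
by rewrite ind_pure1Z -e.
Qed.

Lemma basis_span (J : choiceType) (y : J -> g) :
  is_basis (lpi p @` whittaker_ann phi) (fun j : J => lpi p (y j)) ->
  forall x, whittaker_ann phi x -> exists2 z, z \in spanS (range y) & x - z \in p.
Proof.
move=> [_ _ sp] x xH; have /sp/spanSP xs : (lpi p @` whittaker_ann phi) (lpi p x).
  by exists x.
suff [z zy /esym/lpi_eq xz] : exists2 z, z \in spanS (range y) & lpi p z = lpi p x.
  by exists z.
(* Generalizing over the class of [x] lets the span induction run in the quotient, with lifts chosen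
   termwise. *)
move: (lpi p x) xs; apply: span_ind => [|a _ _ [u uy <-] [v vy <-]|_ [j _ <-]].
- by exists 0; rewrite ?linear0 ?rpred0.
- by exists (a *: u + v); rewrite ?linearP // rpredD ?rpredZ.
- by exists (y j) => //; apply: span_gen; exists j.
Qed.

End WhittakerModule.

Theorem theorem3p1 (R : realType) (g : lieSuperAlg R[i]) (p : gradedIdeal g)
  (phi : lieSuperHom (ideal_lsa p) (scalar_lsa R[i]))
  (d : Order.disp_t) (J : orderType d) (y : J -> g) :
  well_founded (fun i j : J => (i < j)%O) ->
  (forall j : J, homogeneous (y j)) ->
  (forall j : J, whittaker_ann phi (y j)) ->
  is_basis (lpi p @` whittaker_ann phi) (fun j : J => lpi p (y j)) ->
  quasi_whittaker phi (wmod phi) =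
    [set uact (@act _ _ (wmod phi)) u (wphi phi) | u in yspan y].
Proof.
move=> _ yhom yann ybasis.
apply: quasi_whittaker_cyclic yhom yann (basis_span ybasis) _ _.
  exact: wphi_quasi_whittaker.
exact: wphi_cyclic.
Qed.
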